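(* Let $0\le r\le n-1$, let $G(\mathbf{S})=(G_{r+1}(\mathbf{S}),\dots,G_n(\mathbf{S}))$ have entries in $R[\mathbf{x}][\mathbf{S}]$, and suppose there exist $z\in R\langle\mathbf{x}\rangle^{n-r}$ and data $(\alpha,\beta,\gamma,b,c)$ that are admissible for $z$ (as defined in the context). Then there is a unique solution $\mathbf{s}$ of $G(\mathbf{S})=0$ with entries in $\pi R\langle\mathbf{x}\rangle^\dagger$. It can be computed using Newton iteration with $z_0=z$ and $z_{m+1}=z_m+\varepsilon_m$ for $m\ge0$, with $\varepsilon_m=-\mathrm{Jac}_G(z_m)^{-1}G(z_m)$. Then $z_2=z''$ comes with $\alpha''$, $\beta''$ and $b''$ (obtained by applying the update rule of the context twice) that no longer change under further iteration, and all $z_m$ with $m\ge2$, as well as $\mathbf{s}$, have entries in $W(\alpha'',\beta'')$. As a simple estimate, if we let $$M=\max{}^{+}_{\substack{i=1,\dots,n-r\\ |J|=2,\dots,N}}\bigl\{\alpha^{-1}\cdot(\delta_{r+i,J}+(|J|-1)\beta)\bigr\},$$ then all $z_m$, as well as $\mathbf{s}$, have entries in $W((1+\mu)\alpha,\beta)$ for $\mu=\tfrac32c^{-1}M$.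
   Context: $R$ is the valuation ring of a finite extension $K$ of $\mathbb{Q}_p$, with uniformiser $\pi$ and valuation $v$ with $v(p)=1$. $R\langle\mathbf{x}\rangle=R\langle x_1,\dots,x_n\rangle$ is the ring of power series over $R$ whose coefficients tend to $0$, and $R\langle\mathbf{x}\rangle^\dagger$ the subring of overconvergent ones: $\sum a_I\mathbf{x}^I$ such that there are $\gamma>0$, $\delta$ with $v(a_I)\ge\gamma|I|+\delta$ for all $I$. For $\alpha\in(\mathbb{R}_{>0})^n$ put $\alpha^{-1}=(\alpha_1^{-1},\dots,\alpha_n^{-1})$; the dot is the inner product. For $\beta\in\mathbb{R}^n$, $W(\alpha,\beta)=\{\sum a_D\mathbf{x}^D\in R\langle\mathbf{x}\rangle: v(a_D)\ge\alpha^{-1}\cdot(D-\beta)\ \forall D\}$; for $c\ge0$, $V(c)=\{\sum a_D\mathbf{x}^D\in R\langle\mathbf{x}\rangle:v(a_D)\ge c\ \forall D\}$. $\max^+$ is the maximum of the indicated set together with $0$. $\mathrm{Jac}_G$ is the Jacobian with respect to $\mathbf{S}=(S_{r+1},\dots,S_n)$. Write $G_j(\mathbf{S})=\sum_{l=0}^N\sum_{|J|=l}G_{j,J}(\mathbf{x})\mathbf{S}^J$ for some $N\ge2$. Admissible data for $z$: $\alpha\in(\mathbb{R}_{>0})^n$, $b>0$, $c>0$, $\beta,\gamma\in\mathbb{R}^n$ with (1) $z$ has entries in $W(\alpha,\beta)\cap V(b)$; (2) each $G_j(z)\in W(\alpha,\gamma)\cap V(c)$; (3) $\mathrm{Jac}_G(z)$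 has entries in $W(\alpha,0)$ and determinant in $W(\alpha,0)^*$; (4) $\alpha^{-1}\cdot\gamma\le\alpha^{-1}\cdot\beta$. Moreover $\delta_{r+i,J}\in\mathbb{R}^n$ are fixed with $G_{r+i,J}\in W(\alpha,\delta_{r+i,J})$ for $|J|\ge2$. Update rule (one Newton step $z\mapsto z'=z-\mathrm{Jac}_G(z)^{-1}G(z)$): $b'=\min\{b,c\}$, $c'=2c$, $\alpha'=(1+\lambda)\alpha$ with $$\lambda=\max_{1\le i,j\le n-r}\ \max{}^{+}_{|J|=2,\dots,N,\ 0<K\le J^{(j)}}\left\{\alpha^{-1}\cdot\frac{\delta_{r+i,J}+(|J|-|K|-1)\beta+|K|\gamma}{(|J|-|K|-1)b+|K|c}\right\},$$ where $J^{(j)}$ is $J$ with $1$ subtracted in position $j$, $K\in\mathbb{Z}_{\ge0}^{n-r}$, $\le$ is entrywise, and $0<K$ means $0\le K\ne 0$; $\beta'$ with $\alpha^{-1}\cdot\beta'=\alpha^{-1}\cdot\beta-\lambda b'$; and $\gamma'$ with $\alpha^{-1}\cdot\gamma'$ equal to the maximum over $i=1,\dots,n-r$, $|J|=2,\dots,N$, $0\le K\le J$, $|K|\ge2$ of $\alpha^{-1}\cdot(\delta_{r+i,J}+(|J|-|K|)\beta+|K|\gamma)-\lambda((|J|-|K|)b+|K|c)$. The primed data are then admissible for $z'$ (with the same $\delta_{r+i,J}$), and the rule can be repeated, giving double-primed data, etc. *)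

(* Defs.v *)
From HB Require Import structures.
From mathcomp Require Import all_boot all_order all_algebra all_field.
(* mpoly has to come before the mathcomp-analysis files: their notations clash
   in the other order. *)
From mathcomp Require Import mpoly.
From mathcomp Require Import boolp reals constructive_ereal.

Set Implicit Arguments.
Unset Strict Implicit.
Unset Printing Implicit Defensive.

Import Order.TTheory GRing.Theory Num.Theory.

Local Open Scope ring_scope.

Section Valuation.
Variables (Rl : realType) (F : fieldType).

Record valuation := Valuation {
  valuation_fun :> F -> \bar Rl;
  valuation_eqy : forall x, valuation_fun x = +oo%E <-> x = 0;
  valuation_neqNy : forall x, valuation_fun x <> -oo%E;
  valuationM : forall x y,
    valuation_fun (x * y) = (valuation_fun x + valuation_fun y)%E;
  valuationD : forall x y,
    (Order.min (valuation_fun x) (valuation_fun y) <= valuation_fun (x + y)%R)%E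
}.

Variable v : valuation.

Lemma valuation0 : v 0 = +oo%E. Proof. by apply/valuation_eqy. Qed.

Lemma valuation1 : v 1 = 0%E.
Proof.
have := valuationM v 1 1; rewrite mulr1.
have := valuation_neqNy (v := v) (x := 1).
have : v 1 <> +oo%E by move/(valuation_eqy v)/eqP; rewrite oner_eq0.
case: (v 1) => [r| |] // _ _ /eqP; rewrite -EFinD eqe => /eqP rE.
by congr EFin; apply: (addrI r); rewrite addr0.
Qed.

Lemma valuationN x : v (- x) = v x.
Proof.
suff v1 : v (-1) = 0%E by rewrite -mulN1r valuationM v1 add0e.
have := valuationM v (-1) (-1); rewrite mulrNN mulr1 valuation1.
have := valuation_neqNy (v := v) (x := -1).
case: (v (-1)) => [r| |] // _ /eqP; rewrite -EFinD eqe eq_sym -mulr2n.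
by rewrite mulrn_eq0 => /eqP ->.
Qed.

Lemma valuation_leD (c : \bar Rl) x y :
  (c <= v x -> c <= v y -> c <= v (x + y)%R)%E.
Proof.
by move=> cx cy; apply: le_trans (valuationD v x y); rewrite le_min cx cy.
Qed.

Lemma valuation_le_sum (c : \bar Rl) (I : Type) (s : seq I) (P : pred I)
    (f : I -> F) :
  (forall i, P i -> c <= v (f i))%E -> (c <= v (\sum_(i <- s | P i) f i)%R)%E.
Proof.
move=> cf; elim/big_rec: _ => [|i x Pi cx]; first by rewrite valuation0 leey.
exact: valuation_leD (cf i Pi) cx.
Qed.

Definition vring_pred : {pred F} := fun x => (0%E <= v x)%E.

Lemma vring_subring_closed : subring_closed vring_pred.
Proof.
split=> [|x y|x y]; rewrite !unfold_in /vring_pred.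
- by rewrite valuation1.
- by move=> x0 y0; apply: valuation_leD; rewrite ?valuationN.
- by move=> x0 y0; rewrite valuationM adde_ge0.
Qed.

HB.instance Definition _ := GRing.isSubringClosed.Build F vring_pred
  vring_subring_closed.

Record vring := Vring { vring_val :> F; _ : vring_val \in vring_pred }.

HB.instance Definition _ := [isSub for vring_val].
HB.instance Definition _ := [Choice of vring by <:].
HB.instance Definition _ := [SubChoice_isSubComNzRing of vring by <:].

Lemma vring_ge0 (x : vring) : (0%E <= v x)%E.
Proof. exact: (valP x). Qed.

(* A generator of the maximal ideal {x | v x > 0} of the valuation ring. *)
Definition uniformiser (pi : vring) :=
  forall x : vring, (0%E < v x)%E <-> exists y, x = pi * y.

End Valuation.

Definition padic_val (Rl : realType) (p : nat) (q : rat) : \bar Rl :=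
  if q == 0 then +oo%E
  else ((logn p `|numq q|)%:R - (logn p `|denq q|)%:R)%:E.

(* (Qp, w) is a completion of the rationals for the p-adic valuation, which
   characterizes it up to a unique isomorphism of valued fields; the first
   clause forces Qp to have characteristic 0, so that ratr is the embedding
   of the rationals. *)
Definition is_Qp (Rl : realType) (p : nat) (Qp : fieldType)
    (w : valuation Rl Qp) : Prop :=
  [/\ forall q : rat, w (ratr q) = padic_val Rl p q,
      forall (x : Qp) (C : Rl), exists q : rat, (C%:E <= w (x - ratr q)%R)%E
    & forall u : nat -> Qp,
        (forall C : Rl, exists M, forall i j, (M <= i)%N -> (M <= j)%N ->
           (C%:E <= w (u i - u j)%R)%E) ->
        exists l, forall C : Rl, exists M, forall i, (M <= i)%N ->
           (C%:E <= w (u i - l)%R)%E].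

(* Formal power series in n variables: a series is its coefficient function. *)
Definition mfps (R : Type) (n : nat) := 'X_{1..n} -> R.

Section MFPS.
Variables (R : comNzRingType) (n : nat).
Local Notation mfps := (mfps R n).
Implicit Types (f g h : mfps) (D : 'X_{1..n}).

HB.instance Definition _ := gen_eqMixin mfps.
HB.instance Definition _ := gen_choiceMixin mfps.

Definition mfps_zero : mfps := fun=> 0.
Definition mfps_opp f : mfps := fun D => - f D.
Definition mfps_add f g : mfps := fun D => f D + g D.
Definition mfps_one : mfps := fun D => (D == 0%MM)%:R.
(* Same formula as mcoeffM. *)
Definition mfps_mul f g : mfps := fun D =>
  \sum_(k : 'X_{1..n < (mdeg D).+1, (mdeg D).+1} | D == (k.1 + k.2)%MM)
    f k.1 * g k.2.

Fact mfps_addA : associative mfps_add.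
Proof. by move=> f g h; apply/funext => D; apply: addrA. Qed.
Fact mfps_addC : commutative mfps_add.
Proof. by move=> f g; apply/funext => D; apply: addrC. Qed.
Fact mfps_add0 : left_id mfps_zero mfps_add.
Proof. by move=> f; apply/funext => D; apply: add0r. Qed.
Fact mfps_addN : left_inverse mfps_zero mfps_opp mfps_add.
Proof. by move=> f; apply/funext => D; apply: addNr. Qed.

HB.instance Definition _ :=
  GRing.isZmodule.Build mfps mfps_addA mfps_addC mfps_add0 mfps_addN.

Definition mfps_trunc d f : {mpoly R[n]} :=
  \sum_(k : 'X_{1..n < d}) f k *: 'X_[k].

Lemma mcoeff_trunc d f D : (mdeg D < d)%N -> (mfps_trunc d f)@_D = f D.
Proof. by move=> dD; rewrite mcoeff_mpoly. Qed.

Lemma mfps_mulE d f g D : (mdeg D < d)%N ->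
  mfps_mul f g D = (mfps_trunc d f * mfps_trunc d g)@_D.
Proof.
move=> dD; rewrite mcoeffM; apply: eq_bigr => -[a b] /= _.
by rewrite !mcoeff_trunc // (leq_trans (bmdeg _)).
Qed.

Lemma mcoeffM_eq (p q p' q' : {mpoly R[n]}) D :
  (forall E, (mdeg E <= mdeg D)%N -> p@_E = p'@_E) ->
  (forall E, (mdeg E <= mdeg D)%N -> q@_E = q'@_E) ->
  (p * q)@_D = (p' * q')@_D.
Proof.
move=> pp' qq'; rewrite !mcoeffM; apply: eq_bigr => -[a b] /= _.
by rewrite pp' ?qq' // -ltnS bmdeg.
Qed.

Lemma mfps_trunc_mul d f g D : (mdeg D < d)%N ->
  (mfps_trunc d (mfps_mul f g))@_D = (mfps_trunc d f * mfps_trunc d g)@_D.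
Proof. by move=> dD; rewrite mcoeff_trunc // (mfps_mulE f g dD). Qed.

Fact mfps_mulA : associative mfps_mul.
Proof.
move=> f g h; apply/funext => D; have dD := ltnSn (mdeg D).
rewrite !(mfps_mulE _ _ dD); set d := (mdeg D).+1 in dD *.
transitivity (mfps_trunc d f * (mfps_trunc d g * mfps_trunc d h))@_D.
  by apply: mcoeffM_eq => // E ED; rewrite mfps_trunc_mul.
by rewrite mulrA; apply: mcoeffM_eq => // E ED; rewrite mfps_trunc_mul.
Qed.

Fact mfps_mulC : commutative mfps_mul.
Proof.
move=> f g; apply/funext => D; have dD := ltnSn (mdeg D).
by rewrite !(mfps_mulE _ _ dD) mulrC.
Qed.

Fact mfps_mul1 : left_id mfps_one mfps_mul.
Proof.
move=> f; apply/funext => D; have dD := ltnSn (mdeg D).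
rewrite (mfps_mulE _ _ dD) -[RHS](mcoeff_trunc f dD) -[X in _ = X@_D]mul1r.
apply: mcoeffM_eq => // E ED.
by rewrite mcoeff_trunc // mcoeff1.
Qed.

Fact mfps_mulDl : left_distributive mfps_mul mfps_add.
Proof.
move=> f g h; apply/funext => D; rewrite /mfps_add /mfps_mul -big_split /=.
by apply: eq_bigr => k _; rewrite mulrDl.
Qed.

Fact mfps_one_neq0 : mfps_one != 0.
Proof.
apply/eqP => /(congr1 (fun f : mfps => f 0%MM)) /eqP.
by rewrite /mfps_one eqxx oner_eq0.
Qed.

HB.instance Definition _ := GRing.Zmodule_isComNzRing.Build mfps
  mfps_mulA mfps_mulC mfps_mul1 mfps_mulDl mfps_one_neq0.

End MFPS.

Section Tate.
Variables (Rl : realType) (F : fieldType) (v : valuation Rl F) (n : nat).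

Definition tate_pred : {pred mfps (vring v) n} := fun f =>
  `[< forall C : Rl, exists N, forall D : 'X_{1..n}, (N <= mdeg D)%N ->
        (C%:E <= v (f D))%E >].

Lemma tate_subring_closed : subring_closed tate_pred.
Proof.
split=> [|f g /asboolP tf /asboolP tg|f g /asboolP tf /asboolP tg];
    apply/asboolP => C.
- exists 1%N => D D1; rewrite /GRing.one /= /mfps_one.
  have /negPf -> : D != 0%MM by rewrite -mdeg_eq0 -lt0n.
  by rewrite valuation0 leey.
- have [Nf hf] := tf C; have [Ng hg] := tg C.
  exists (maxn Nf Ng) => D; rewrite geq_max => /andP[Df Dg].
  by apply: valuation_leD; [exact: hf|rewrite /= valuationN; exact: hg].
- have [Nf hf] := tf C; have [Ng hg] := tg C.
  exists (Nf + Ng)%N => D DN; rewrite /GRing.mul /= /mfps_mul.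
  rewrite -[vring_val _]/(val _) raddf_sum /=.
  apply: valuation_le_sum => -[a b] /= /eqP/(congr1 mdeg); rewrite mdegD => DE.
  rewrite valuationM; have [aN|aN] := leqP Nf (mdeg a).
    by rewrite -[C%:E]adde0; apply: leeD; [exact: hf|exact: vring_ge0].
  rewrite -[C%:E]add0e; apply: leeD; [exact: vring_ge0|apply: hg].
  rewrite -(leq_add2l (mdeg a)) -DE; apply: leq_trans DN.
  by rewrite leq_add2r ltnW.
Qed.

HB.instance Definition _ := GRing.isSubringClosed.Build _ tate_pred
  tate_subring_closed.

(* The ring R<x> of power series over the valuation ring R of v with
   coefficients tending to 0. *)
Record tate := Tate { tate_val : mfps (vring v) n;
                     _ : tate_val \in tate_pred }.

Definition tate_coef (f : tate) : 'X_{1..n} -> vring v := tate_val f.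
Coercion tate_coef : tate >-> Funclass.

HB.instance Definition _ := [isSub for tate_val].
HB.instance Definition _ := [Choice of tate by <:].
HB.instance Definition _ := [SubChoice_isSubComNzRing of tate by <:].

Definition tate_unit : {pred tate} := fun f => `[< exists g, g * f = 1 >].
Definition tate_inv (f : tate) : tate :=
  if pselect (exists g, g * f = 1) is left e then projT1 (cid e) else f.

Fact tate_mulVx : {in tate_unit, left_inverse 1 tate_inv *%R}.
Proof.
move=> f /asboolP uf; rewrite /tate_inv; case: pselect => // e.
exact: (projT2 (cid e)).
Qed.
Fact tate_unitPl (f g : tate) : g * f = 1 -> tate_unit f.
Proof. by move=> gf; apply/asboolP; exists g. Qed.
Fact tate_inv_out : {in [predC tate_unit], tate_inv =1 id}.
Proof.
move=> f nf; rewrite /tate_inv; case: pselect => // e.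
by move: nf; rewrite inE => /asboolP; case.
Qed.

HB.instance Definition _ := GRing.ComNzRing_hasMulInverse.Build tate
  tate_mulVx tate_unitPl tate_inv_out.

Fact tate_of_mpoly_subproof (p : {mpoly (vring v)[n]}) :
  (fun D => p@_D) \in tate_pred.
Proof.
apply/asboolP => C; exists (msize p) => D pD.
by rewrite memN_msupp_eq0 ?valuation0 ?leey // msize_mdeg_ge.
Qed.

Definition tate_of_mpoly (p : {mpoly (vring v)[n]}) : tate :=
  Tate (tate_of_mpoly_subproof p).

Fact tate_of_mpoly_zmod : zmod_morphism tate_of_mpoly.
Proof. by move=> p q; apply/val_inj/funext => D; rewrite /= mcoeffB. Qed.
Fact tate_of_mpoly_monoid : monoid_morphism tate_of_mpoly.
Proof.
split=> [|p q]; apply/val_inj/funext => D; rewrite /=; first exact: mcoeff1.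
exact: mcoeffM.
Qed.

HB.instance Definition _ := GRing.isZmodMorphism.Build _ _ tate_of_mpoly
  tate_of_mpoly_zmod.
HB.instance Definition _ := GRing.isMonoidMorphism.Build _ _ tate_of_mpoly
  tate_of_mpoly_monoid.

Definition overconvergent (f : tate) : Prop :=
  exists c d : Rl, 0 < c /\
    forall D : 'X_{1..n}, ((c * (mdeg D)%:R + d)%R%:E <= v (f D))%E.

(* Membership in the ideal pi R<x>^dagger of R<x>^dagger. *)
Definition in_pi_dagger (pi : vring v) (f : tate) : Prop :=
  exists2 g : tate, overconvergent g & forall D, f D = pi * g D.

Definition dot (x y : 'rV[Rl]_n) : Rl := \sum_(i < n) x 0 i * y 0 i.
Definition invv (x : 'rV[Rl]_n) : 'rV[Rl]_n := map_mx GRing.inv x.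
Definition expv (D : 'X_{1..n}) : 'rV[Rl]_n := \row_i (D i)%:R.

Definition Wset (alpha beta : 'rV[Rl]_n) (f : tate) : Prop :=
  forall D, ((dot (invv alpha) (expv D - beta)%R)%:E <= v (f D))%E.
Definition Vset (c : Rl) (f : tate) : Prop := forall D, (c%:E <= v (f D))%E.

Variable k : nat.
Variable G : 'I_k -> {mpoly {mpoly (vring v)[n]}[k]}.
Implicit Types z : 'cV[tate]_k.

Definition evalS (P : {mpoly {mpoly (vring v)[n]}[k]}) z : tate :=
  mmap tate_of_mpoly (fun i => z i 0) P.
Definition evalG z : 'cV[tate]_k := \col_j evalS (G j) z.
Definition JacG z : 'M[tate]_k := \matrix_(i, j) evalS (mderiv j (G i)) z.

Definition newton z0 (m : nat) : 'cV[tate]_k :=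
  iter m (fun z => z - invmx (JacG z) *m evalG z) z0.

Definition Gsolution (pi : vring v) (s : 'cV[tate]_k) : Prop :=
  evalG s = 0 /\ forall i, in_pi_dagger pi (s i 0).

End Tate.

Section Data.
Variables (Rl : realType) (n : nat).
Local Notation vec := 'rV[Rl]_n.

Record newton_data := NewtonData {
  nalpha : vec; nbeta : vec; ngamma : vec; nb : Rl; nc : Rl }.

Definition admissible (F : fieldType) (v : valuation Rl F) (k : nat)
    (G : 'I_k -> {mpoly {mpoly (vring v)[n]}[k]})
    (d : newton_data) (z : 'cV[tate v n]_k) : Prop :=
  [/\ [/\ forall i, 0 < nalpha d 0 i, 0 < nb d & 0 < nc d],
      forall i, Wset (nalpha d) (nbeta d) (z i 0) /\ Vset (nb d) (z i 0),
      forall j, Wset (nalpha d) (ngamma d) (evalG G z j 0) /\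
                Vset (nc d) (evalG G z j 0),
      (forall i j, Wset (nalpha d) 0 (JacG G z i j)) /\
      (Wset (nalpha d) 0 (\det (JacG G z)) /\
       exists2 u, Wset (nalpha d) 0 u & \det (JacG G z) * u = 1)
    & dot (invv (nalpha d)) (ngamma d) <= dot (invv (nalpha d)) (nbeta d)].

Variables (k N : nat) (delta : 'I_k -> 'X_{1..k} -> vec).

(* K <= J^(j) is written K + U_(j) <= J: when J has exponent 0 in position j,
   J^(j) has a negative entry and no K qualifies. *)
Definition update_lambda (d : newton_data) : Rl :=
  \big[Num.max/0]_(i < k) \big[Num.max/0]_(j < k)
  \big[Num.max/0]_(J : 'X_{1..k < N.+1} | (2 <= mdeg J)%N)
  \big[Num.max/0]_(K : 'X_{1..k < N.+1} |
                     (bmnm K != 0%MM) && (K + U_(j) <= J)%MM)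
    (dot (invv (nalpha d))
       (delta i J + nbeta d *+ (mdeg J - mdeg K - 1) + ngamma d *+ mdeg K)
     / (nb d *+ (mdeg J - mdeg K - 1) + nc d *+ mdeg K)).

(* A maximum over a nonempty set when 0 < k and 2 <= N. *)
Definition update_gamma (d : newton_data) : \bar Rl :=
  \big[Order.max/-oo%E]_(i < k)
  \big[Order.max/-oo%E]_(J : 'X_{1..k < N.+1} | (2 <= mdeg J)%N)
  \big[Order.max/-oo%E]_(K : 'X_{1..k < N.+1} |
                           (2 <= mdeg K)%N && (K <= J)%MM)
    (dot (invv (nalpha d))
       (delta i J + nbeta d *+ (mdeg J - mdeg K) + ngamma d *+ mdeg K)
     - update_lambda d * (nb d *+ (mdeg J - mdeg K) + nc d *+ mdeg K))%:E.

(* A relation, as beta' and gamma' are only determined through their products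
   with alpha^-1. *)
Definition newton_update (d d' : newton_data) : Prop :=
  [/\ nb d' = Num.min (nb d) (nc d),
      nc d' = 2 * nc d,
      nalpha d' = (1 + update_lambda d) *: nalpha d,
      dot (invv (nalpha d)) (nbeta d') =
        dot (invv (nalpha d)) (nbeta d) - update_lambda d * nb d'
    & (dot (invv (nalpha d)) (ngamma d'))%:E = update_gamma d].

Lemma dot_invv_surj (a : vec) (t : Rl) : (0 < n)%N ->
  (forall i, 0 < a 0 i) -> exists x, dot (invv a) x = t.
Proof.
move=> n0 a0; pose i0 := Ordinal n0.
exists (\row_i (if i == i0 then t * a 0 i else 0)).
rewrite /dot (bigD1 i0) //= big1 ?addr0 => [|i /negPf ii0].
  by rewrite !mxE eqxx mulrCA mulVf ?mulr1 // gt_eqF.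
by rewrite !mxE ii0 mulr0.
Qed.

Lemma bigmax_fin_num (I : finType) (P : pred I) (F : I -> \bar Rl) :
  (forall i, P i -> (F i < +oo)%E) ->
  (\big[Order.max/-oo%E]_(i | P i) F i < +oo)%E.
Proof.
move=> hF; elim/big_rec: _ => [|i x Pi hx]; first by [].
by rewrite gt_max hF.
Qed.

Lemma update_lambda_ge0 d : 0 <= update_lambda d.
Proof. exact: bigmax_ge_id. Qed.

Lemma update_gamma_fin d : (0 < k)%N -> (2 <= N)%N ->
  exists t : Rl, update_gamma d = t%:E.
Proof.
move=> k0 N2; pose i0 := Ordinal k0.
have J2 : (mdeg (U_(i0) + U_(i0))%MM < N.+1)%N by rewrite mdegD mdeg1.
pose J0 := BMultinom J2.
have dJ0 : (2 <= mdeg J0)%N by rewrite /= mdegD mdeg1.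
have hy : (update_gamma d < +oo)%E.
  by do 3!apply: bigmax_fin_num => ? _; rewrite ltry.
have hN : (-oo < update_gamma d)%E.
  have J0J0 : (2 <= mdeg J0)%N && (J0 <= J0)%MM by rewrite dJ0 lepm_refl.
  apply: (@lt_le_trans _ _ (_%:E)) (ltNyr _) _.
  apply: (bigmax_sup i0) => //; apply: (bigmax_sup J0) => //.
  by apply: (bigmax_sup J0) => //; apply: lexx.
by case: (update_gamma d) hy hN => [t| |] // _ _; exists t.
Qed.

Lemma newton_update_total d : (0 < n)%N -> (0 < k)%N -> (2 <= N)%N ->
  (forall i, 0 < nalpha d 0 i) ->
  exists2 d', newton_update d d' & forall i, 0 < nalpha d' 0 i.
Proof.
move=> n0 k0 N2 a0; have [t tE] := update_gamma_fin d k0 N2.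
have [g gE] := dot_invv_surj t n0 a0.
have [b bE] := dot_invv_surj (dot (invv (nalpha d)) (nbeta d)
  - update_lambda d * Num.min (nb d) (nc d)) n0 a0.
exists (NewtonData ((1 + update_lambda d) *: nalpha d) b g
  (Num.min (nb d) (nc d)) (2 * nc d)).
  by split; rewrite //= gE tE.
move=> i; rewrite /= mxE mulr_gt0 // ltr_wpDr ?ltr01 //.
exact: update_lambda_ge0.
Qed.

Definition estimate_M (d : newton_data) : Rl :=
  \big[Num.max/0]_(i < k)
  \big[Num.max/0]_(J : 'X_{1..k < N.+1} | (2 <= mdeg J)%N)
    dot (invv (nalpha d)) (delta i J + nbeta d *+ (mdeg J - 1)).

End Data.

(* Main.v *)
(* Expand G(z + T eps) along powers of T. The terms of order l coming from the
   monomial S^J lie in W(alpha, delta_J + (|J|-l) beta + l gamma) and in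
   V((|J|-l) b + l c), and an element of W(alpha, x) and V(y) also lies in
   W((1+lambda) alpha, x') as soon as
   alpha^-1.x' >= alpha^-1.x - lambda y. The number lambda of the update rule
   is what makes the terms of order >= 1 of the Jacobian land in W(alpha', 0);
   its determinant stays invertible there because an element of W(alpha', 0) is
   a unit as soon as its constant term is a unit. Terms of order >= 2 in G bound
   G(z'). Comparing the two expansions gives gamma' <= gamma - lambda c, so that
   lambda vanishes once b <= c at the previous step, hence from the second step
   on; the estimate follows from lambda <= M/c and lambda' <= M/(2(1+lambda)c).
   Since eps_m lies in V(2^m c), the z_m converge coefficientwise, K being
   complete as a finite extension of a complete field. Two solutions
   whose difference is in V(x) have difference in V(x + min(x, c)), hence
   coincide. *)
Require Import Defs.
From HB Require Import structures.
From mathcomp Require Import all_boot all_order all_algebra all_field.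
From mathcomp Require Import mpoly.
From mathcomp Require Import boolp reals constructive_ereal.
From mathcomp Require Import zify ring lra.

Set Implicit Arguments.
Unset Strict Implicit.
Unset Printing Implicit Defensive.

Import Order.TTheory GRing.Theory Num.Theory.

Local Open Scope ring_scope.

Lemma le_archi_bound (Rl : realType) (x : Rl) k :
  (Num.bound x <= k)%N -> x <= k%:R.
Proof.
move=> xk; apply: (@le_trans _ _ (Num.bound x)%:R); last by rewrite ler_nat.
apply: le_trans (ler_norm x) _; apply: ltW.
by have := archi_boundP (normr_ge0 x); rewrite /Num.bound normr_id.
Qed.

(** * Weights *)

Section Dot.
Variables (Rl : realType) (n : nat).
Implicit Types (a x y : 'rV[Rl]_n) (D E : 'X_{1..n}).

Lemma dotD a x y : dot a (x + y) = dot a x + dot a y.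
Proof. by rewrite -big_split; apply: eq_bigr => i _; rewrite mxE mulrDr. Qed.

Lemma dotB a x y : dot a (x - y) = dot a x - dot a y.
Proof. by rewrite -sumrB; apply: eq_bigr => i _; rewrite !mxE mulrBr. Qed.

Lemma dotMn a x m : dot a (x *+ m) = dot a x *+ m.
Proof. by rewrite -sumrMnl; apply: eq_bigr => i _; rewrite mulmxnE mulrnAr. Qed.

Lemma dot0 a : dot a 0 = 0.
Proof. by apply: big1 => i _; rewrite mxE mulr0. Qed.

Lemma dot_invvZ t a x : dot (invv (t *: a)) x = t^-1 * dot (invv a) x.
Proof.
by rewrite mulr_sumr; apply: eq_bigr => i _; rewrite !mxE invfM mulrA.
Qed.

Lemma expvD D E : Defs.expv Rl (D + E)%MM = Defs.expv Rl D + Defs.expv Rl E.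
Proof. by apply/rowP => i; rewrite !mxE mnmDE natrD. Qed.

Lemma expv0 : Defs.expv Rl (0%MM : 'X_{1..n}) = 0.
Proof. by apply/rowP => i; rewrite !mxE mnm0E. Qed.

(** No entry of [a] exceeds [s], so [s^-1] bounds the entries of [invv a] from below. Bounds in [W]
    thus become linear in the total degree, which gives convergence and overconvergence. *)
Lemma dot_expv_ge (a : 'rV[Rl]_n) : (forall i, 0 < a 0 i) ->
  exists2 c : Rl, 0 < c &
    forall D, c * (mdeg D)%:R <= dot (invv a) (Defs.expv Rl D).
Proof.
move=> a0; pose s := 1 + \sum_i a 0 i.
have s0 : 0 < s by rewrite ltr_wpDr // sumr_ge0 // => i _; exact: ltW.
exists s^-1; first by rewrite invr_gt0.
move=> D; rewrite mdegE natr_sum mulr_sumr; apply: ler_sum => i _.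
rewrite !mxE ler_wpM2r // lef_pV2 ?posrE // /s (bigD1 i) //=.
by rewrite addrCA lerDl addr_ge0 // sumr_ge0 // => j _; exact: ltW.
Qed.

End Dot.

(** * The filtrations W and V *)

Arguments tate_coef : simpl never.

Section Filtration.
Variables (Rl : realType) (F : fieldType) (v : valuation Rl F) (n : nat).
Implicit Types (f g : tate v n) (a x y : 'rV[Rl]_n) (D E : 'X_{1..n}).

(** Common form of both filtrations: [Vset] has a constant height and [Wset] an affine one, so
    closure properties are proved once. *)
Definition hset (h : 'X_{1..n} -> Rl) f := forall D, ((h D)%:E <= v (f D))%E.

Lemma vring_valD (x y : vring v) : (x + y : vring v) = (x : F) + (y : F) :> F.
Proof. by []. Qed.
Lemma vring_valN (x : vring v) : (- x : vring v) = - (x : F) :> F.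
Proof. by []. Qed.
Lemma vring_val0 : (0 : vring v) = 0 :> F. Proof. by []. Qed.
Lemma tate_coefD f g D : (f + g) D = f D + g D. Proof. by []. Qed.
Lemma tate_coefN f D : (- f) D = - f D. Proof. by []. Qed.
Lemma tate_coef0 D : (0 : tate v n) D = 0. Proof. by []. Qed.
Lemma tate_coef1 D : (1 : tate v n) D = (D == 0%MM)%:R. Proof. by []. Qed.
Lemma tate_coefM f g D : (f * g) D =
  \sum_(k : 'X_{1..n < (mdeg D).+1, (mdeg D).+1} | D == (k.1 + k.2)%MM)
    f k.1 * g k.2.
Proof. by []. Qed.

Lemma tateP f g : (forall D, f D = g D) -> f = g.
Proof. by move=> fg; apply/val_inj/funext. Qed.

Lemma tate_coefM0 f g : (f * g) 0%MM = f 0%MM * g 0%MM.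
Proof.
rewrite tate_coefM.
have d0 : (mdeg (0%MM : 'X_{1..n}) < (mdeg (0%MM : 'X_{1..n})).+1)%N by [].
rewrite (bigD1 (BMultinom d0, BMultinom d0)) /=; last by rewrite addm0.
rewrite big1 ?addr0 // => -[[p pP] [q qP]] /= /andP[_].
have d0_eq0 (m : 'X_{1..n}) :
    (mdeg m < (mdeg (0%MM : 'X_{1..n})).+1)%N -> m = 0%MM.
  by rewrite mdeg0 ltnS leqn0 mdeg_eq0 => /eqP.
have p0 := d0_eq0 _ pP; have q0 := d0_eq0 _ qP; subst p q.
by case/eqP; congr pair; exact: val_inj.
Qed.

Lemma hset0 h : hset h 0.
Proof. by move=> D; rewrite tate_coef0 vring_val0 valuation0 leey. Qed.

Lemma hsetD h f g : hset h f -> hset h g -> hset h (f + g).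
Proof. move=> hf hg D; rewrite tate_coefD vring_valD.
exact: valuation_leD (hf D) (hg D). Qed.

Lemma hsetN h f : hset h f -> hset h (- f).
Proof. by move=> hf D; rewrite tate_coefN vring_valN valuationN; exact: hf. Qed.

Lemma hsetB h f g : hset h f -> hset h g -> hset h (f - g).
Proof. by move=> hf hg; apply: hsetD => //; exact: hsetN. Qed.

Lemma hset_sum h (I : Type) (r : seq I) (P : pred I) (f : I -> tate v n) :
  (forall i, P i -> hset h (f i)) -> hset h (\sum_(i <- r | P i) f i).
Proof.
by move=> hf; elim/big_rec: _ => [|i x Pi hx]; [exact: hset0|exact/hsetD/hx/hf].
Qed.

Lemma hset_le h h' f : (forall D, h' D <= h D) -> hset h f -> hset h' f.
Proof. by move=> hh hf D; apply: le_trans (hf D); rewrite lee_fin. Qed.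

Lemma hsetM h h1 h2 f g : (forall D E, h (D + E)%MM <= h1 D + h2 E) ->
  hset h1 f -> hset h2 g -> hset h (f * g).
Proof.
move=> hh hf hg D; rewrite tate_coefM -[vring_val _]/(val _) raddf_sum /=.
apply: valuation_le_sum => -[p q] /= /eqP DE; rewrite valuationM.
by apply: le_trans (leeD (hf _) (hg _)); rewrite -EFinD lee_fin (congr1 h DE).
Qed.

Lemma hset_ge0 f : hset (fun=> 0) f. Proof. by move=> D; exact: vring_ge0. Qed.

Definition wheight a (t : Rl) D := dot (invv a) (Defs.expv Rl D) - t.

Lemma WsetE a x f : Wset a x f <-> hset (wheight a (dot (invv a) x)) f.
Proof. by split=> hf D; have := hf D; rewrite /wheight dotB. Qed.

Lemma wsetM a (x y : Rl) f g : hset (wheight a x) f -> hset (wheight a y) g ->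
  hset (wheight a (x + y)) (f * g).
Proof. by apply: hsetM => D E; rewrite /wheight expvD dotD; lra. Qed.

Lemma VsetM b c f g : Vset b f -> Vset c g -> Vset (b + c) (f * g).
Proof. exact: hsetM. Qed.

Lemma VsetMl c f g : Vset c g -> Vset c (f * g).
Proof. by rewrite -{2}[c]add0r; apply: VsetM; exact: hset_ge0. Qed.

Definition W0 a : {pred tate v n} := fun f => `[< hset (wheight a 0) f >].

Lemma W0P a f : reflect (hset (wheight a 0) f) (f \in W0 a).
Proof. exact: asboolP. Qed.

Lemma W0_subring_closed a : subring_closed (W0 a).
Proof.
split=> [|f g|f g].
- apply/W0P => D; rewrite tate_coef1; case: eqVneq => [->|_] /=.
    by rewrite valuation1 /wheight expv0 dot0 subr0.
  by rewrite valuation0 leey.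
- by move=> /W0P hf /W0P hg; apply/W0P/hsetB.
- by move=> /W0P hf /W0P hg; apply/W0P; rewrite -[0]addr0; exact: wsetM.
Qed.

HB.instance Definition _ a := GRing.isSubringClosed.Build _ (W0 a)
  (W0_subring_closed a).

Lemma Wset0E a f : Wset a 0 f <-> f \in W0 a.
Proof. by rewrite WsetE dot0; split => /W0P. Qed.

Lemma tate_exp_coef0 g k D : g 0%MM = 0 -> (mdeg D < k)%N -> (g ^+ k) D = 0.
Proof.
move=> g0; elim: k D => // k IHk D Dk; rewrite exprS tate_coefM.
apply: big1 => -[[p pP] [q qP]] /= /eqP DE.
have [/eqP|p0] := posnP (mdeg p).
  by rewrite mdeg_eq0 => /eqP->; rewrite g0 mul0r.
rewrite IHk ?mulr0 //; move: Dk; rewrite DE mdegD; lia.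
Qed.

(* No completeness is needed: after normalizing the constant term to 1, the
   coefficient of [x^D] in the geometric series of [1 - f] only involves the
   powers up to [|D|]. *)
Lemma W0_unit a f : (forall i, 0 < a 0 i) -> f \in W0 a ->
  v (f 0%MM) = 0%E -> exists2 u, u \in W0 a & f * u = 1.
Proof.
move=> a0 fW f0.
have f0N : (f 0%MM : F) != 0.
  by apply/eqP => f00; move: f0; rewrite f00 valuation0.
have vV : (0 <= v (f 0%MM : F)^-1%R)%E.
  (* Valuation 0 makes the inverse of the constant term integral; [C] below is this inverse as a
     constant series. *)
  have := valuationM v (f 0%MM : F) (f 0%MM : F)^-1.
  by rewrite divff // valuation1 f0 add0e => <-.
pose c : vring v := Vring (vV : (f 0%MM : F)^-1 \in vring_pred v).
have cf : c * f 0%MM = 1 by apply: val_inj; rewrite /= mulVf.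
have cP : (fun D => (D == 0%MM)%:R * c) \in tate_pred (v := v) (n := n).
  apply/asboolP => C; exists 1%N => D D1.
  have /negPf -> : D != 0%MM by rewrite -mdeg_eq0 -lt0n.
  by rewrite mul0r valuation0 leey.
pose C : tate v n := Tate cP.
have CM h D : (C * h) D = c * h D.
  rewrite tate_coefM.
  have d0 : (mdeg (0%MM : 'X_{1..n}) < (mdeg D).+1)%N by rewrite mdeg0.
  have dD : (mdeg D < (mdeg D).+1)%N by [].
  rewrite (bigD1 (BMultinom d0, BMultinom dD)) /=; last by rewrite add0m.
  rewrite {1}/tate_coef /= eqxx mul1r big1 ?addr0 // => -[[p pP] [q qP]] /=.
  case/andP => /eqP DE; rewrite {1}/tate_coef /=.
  case: (eqVneq p 0%MM) => [p0|_ _]; last by rewrite !mul0r.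
  subst p; case/eqP; congr pair; apply: val_inj => //=.
  by rewrite DE add0m.
have CW : C \in W0 a.
  apply/W0P => D; rewrite -[C]mulr1 CM tate_coef1.
  case: eqVneq => [->|_]; last by rewrite mulr0 valuation0 leey.
  by rewrite mulr1 /wheight expv0 dot0 subr0; exact: vring_ge0.
pose g := 1 - C * f.
have gW : g \in W0 a by rewrite rpredB ?rpred1 // rpredM.
have g0 : g 0%MM = 0.
  by rewrite tate_coefD tate_coefN CM tate_coef1 eqxx cf subrr.
pose S d := \sum_(i < d) g ^+ i.
have SW d : S d \in W0 a by apply: rpred_sum => i _; apply: rpredX.
have SE d D : (mdeg D < d)%N -> S d D = S (mdeg D).+1 D.
  elim: d => // d IHd; rewrite ltnS leq_eqVlt => /predU1P[->//|dD].
  by rewrite /S big_ord_recr /= tate_coefD tate_exp_coef0 // addr0; exact: IHd.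
pose hf : mfps (vring v) n := fun D => S (mdeg D).+1 D.
have hW D : ((wheight a 0 D)%:E <= v (hf D))%E by exact/(W0P _ _ (SW _)).
have [e e0 eP] := dot_expv_ge a0.
have hP : hf \in tate_pred (v := v) (n := n).
  apply/asboolP => B; exists (Num.bound (B / e)) => D DB.
  apply: le_trans (hW D); rewrite lee_fin /wheight subr0.
  apply: le_trans (eP D); rewrite mulrC -ler_pdivrMr //.
  exact: le_archi_bound.
pose h : tate v n := Tate hP.
have CfE : C * f = 1 - g by rewrite /g opprB addrC subrK.
exists (C * h); first by rewrite rpredM //; apply/W0P.
(* The coefficient of x^D in a product involves only degrees up to |D|, where [h] agrees with one
   fixed partial sum; multiplied by [1 - g], that sum telescopes. *)
rewrite mulrCA mulrA CfE; apply: tateP => D.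
have -> : ((1 - g) * h) D = ((1 - g) * S (mdeg D).+1) D.
  rewrite !tate_coefM; apply: eq_bigr => -[[p pP] [q qP]] /= _.
  by rewrite [S _ _]SE.
have -> : (1 - g) * S (mdeg D).+1 = 1 - g ^+ (mdeg D).+1.
  by rewrite /S -[1 in RHS](expr1n _ (mdeg D).+1) subrXX; congr (_ * _);
    apply: eq_bigr => i _; rewrite expr1n mul1r.
by rewrite tate_coefD tate_coefN tate_exp_coef0 // subr0.
Qed.

(** Constant terms multiply, and two nonnegative valuations with sum 0 both vanish. *)
Lemma unit_val0 f g : f * g = 1 -> v (f 0%MM) = 0%E.
Proof.
move=> /(congr1 (fun h : tate v n => h 0%MM)); rewrite tate_coefM0 tate_coef1 eqxx.
move/(congr1 (fun h : vring v => v h)); rewrite valuationM valuation1.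
have := vring_ge0 (f 0%MM); have := vring_ge0 (g 0%MM).
case: (v (f 0%MM)) => [r||]; case: (v (g 0%MM)) => [t||] //=.
rewrite !lee_fin => t0 r0 /eqP; rewrite -EFinD eqe => rt.
by congr EFin; apply/eqP; rewrite eq_le; lra.
Qed.

(** This carries invertibility of the Jacobian determinant from one Newton iterate to the next. *)
Lemma val0_cong c f g : 0 < c -> Vset c (f - g) -> v (g 0%MM) = 0%E ->
  v (f 0%MM) = 0%E.
Proof.
move=> c0 /(_ 0%MM) fg g0; apply/eqP; rewrite eq_le vring_ge0 andbT.
rewrite leNgt; apply/negP => f0.
suff : (0 < v (g 0%MM))%E by rewrite g0 ltxx.
have -> : (g 0%MM : F) = f 0%MM - (f - g) 0%MM by rewrite /= opprB addrCA subrr addr0.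
apply: lt_le_trans (valuationD v _ _); rewrite valuationN lt_min f0.
by apply: lt_le_trans fg; rewrite lte_fin.
Qed.

(** [Vset c] absorbs multiplication by arbitrary series, so congruence modulo it passes through
    products, determinants and [evalS]. *)
Lemma cong_mul c f f' g g' : Vset c (f - f') -> Vset c (g - g') ->
  Vset c (f * g - f' * g').
Proof.
move=> hf hg.
have -> : f * g - f' * g' = g * (f - f') + f' * (g - g') by ring.
by apply: hsetD; exact: VsetMl.
Qed.

Lemma cong_refl c f : Vset c (f - f).
Proof. by rewrite subrr; exact: hset0. Qed.

Lemma cong_sum c (I : Type) (r : seq I) (P : pred I) (f g : I -> tate v n) :
  (forall i, P i -> Vset c (f i - g i)) ->
  Vset c (\sum_(i <- r | P i) f i - \sum_(i <- r | P i) g i).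
Proof. by move=> fg; rewrite -sumrB; exact: hset_sum. Qed.

Lemma cong_prod c (I : Type) (r : seq I) (P : pred I) (f g : I -> tate v n) :
  (forall i, P i -> Vset c (f i - g i)) ->
  Vset c (\prod_(i <- r | P i) f i - \prod_(i <- r | P i) g i).
Proof.
move=> fg; elim/big_ind2: _ => // [|*]; [exact: cong_refl|exact: cong_mul].
Qed.

Lemma cong_exp c f g k : Vset c (f - g) -> Vset c (f ^+ k - g ^+ k).
Proof.
move=> fg; elim: k => [|k IHk]; first exact: cong_refl.
by rewrite !exprS; exact: cong_mul.
Qed.

Lemma cong_det c k (A B : 'M[tate v n]_k) :
  (forall i j, Vset c (A i j - B i j)) -> Vset c (\det A - \det B).
Proof.
move=> AB; apply: cong_sum => s _; apply: cong_mul; first exact: cong_refl.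
exact: cong_prod.
Qed.

Lemma cong_evalS c k (P : {mpoly {mpoly (vring v)[n]}[k]}) (z z' : 'cV[tate v n]_k) :
  (forall i, Vset c (z i 0 - z' i 0)) -> Vset c (evalS P z - evalS P z').
Proof.
move=> zz; apply: cong_sum => m _; apply: cong_mul; first exact: cong_refl.
by apply: cong_prod => i _; apply: cong_exp.
Qed.

Lemma W0_det a k (A : 'M[tate v n]_k) :
  (forall i j, A i j \in W0 a) -> \det A \in W0 a.
Proof.
move=> AW; apply: rpred_sum => s _; apply: rpredM; first exact: rpred_sign.
exact: rpred_prod.
Qed.

Lemma W0_invmx a k (A : 'M[tate v n]_k) u : (forall i j, A i j \in W0 a) ->
  u \in W0 a -> \det A * u = 1 -> forall i j, invmx A i j \in W0 a.
Proof.
move=> AW uW Au i j; rewrite /invmx unitmxE.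
have -> : \det A \is a GRing.unit by apply/unitrPr; exists u.
rewrite (mulr1_eq Au) !mxE rpredM // /cofactor rpredM ?rpred_sign //.
by apply: W0_det => p q; rewrite !mxE.
Qed.

Lemma VsetP f g : (forall C, Vset C (f - g)) -> f = g.
Proof.
move=> fg; apply/eqP; rewrite -subr_eq0; apply/eqP/tateP => D.
apply/val_inj/(valuation_eqy v); apply/eqP; rewrite eq_le leey /=.
have := fun C => fg C D; case: (v ((f - g) D)) => [r| |] // H.
  by exfalso; have := H (r + 1)%R; rewrite lee_fin; lra.
by have := H 0.
Qed.

(* Valuation is traded for convergence radius: this is how [lambda] acts. *)
Lemma Wset_scale a x (t l Y : Rl) f : 0 <= l -> hset (wheight a t) f -> Vset Y f ->
  t - l * Y <= dot (invv a) x -> Wset ((1 + l) *: a) x f.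
Proof.
move=> l0 fW fV tx D; have := fW D; have := fV D; rewrite dot_invvZ dotB.
case: (v (f D)) => [r| |]; rewrite ?leey //= !lee_fin /wheight => Yr tr.
rewrite mulrC ler_pdivrMr; last by lra.
suff : l * Y <= l * r by lra.
exact: ler_wpM2l.
Qed.

(** Coefficients have nonnegative valuation, so [t * v (f D) <= T * v (f D)], and a larger shift
    only relaxes the bound. *)
Lemma Wset_weaken a x y (t T : Rl) f : 0 < t -> t <= T ->
  dot (invv a) x <= dot (invv a) y -> Wset (t *: a) x f -> Wset (T *: a) y f.
Proof.
move=> t0 tT xy fW D; have := fW D; have := vring_ge0 (f D).
rewrite !dot_invvZ !dotB.
case: (v (f D)) => [r| |]; rewrite ?leey //= !lee_fin => r0.
rewrite ![_^-1 * _]mulrC !ler_pdivrMr //; last by lra.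
by have := ler_wpM2l r0 tT; lra.
Qed.

(** For each [D] an approximation to the precision demanded at [D] suffices; hence [W] survives
    limits. *)
Lemma Wset_closed a x f : (forall C, exists2 g, Wset a x g & Vset C (f - g)) ->
  Wset a x f.
Proof.
move=> fg D; have [g gW /(_ D) gV] := fg (dot (invv a) (Defs.expv Rl D - x)).
have -> : (f D : F) = (f - g) D + g D by rewrite /= subrK.
exact: valuation_leD.
Qed.

End Filtration.

(** * Taylor expansion *)

Lemma mpoly_ring_ind (R : nzRingType) k (Q : {mpoly R[k]} -> Prop) :
  (forall c, Q c%:MP) -> (forall i, Q 'X_i) ->
  (forall p q, Q p -> Q q -> Q (p + q)) ->
  (forall p q, Q p -> Q q -> Q (p * q)) -> forall p, Q p.
Proof.
move=> QC QX QD QM p; have Q0 : Q 0 by rewrite -mpolyC0.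
have Q1 : Q 1 by rewrite -mpolyC1.
rewrite [p]mpolyE; apply: (big_ind Q) => // m _; rewrite -mul_mpolyC mpolyXE_id.
apply: (QM) => //; apply: (big_ind Q) => // i _.
by elim: (m i) => // l Ql; rewrite exprS; apply: (QM).
Qed.

Lemma mdeg_gt0_ex k (J : 'X_{1..k}) : (0 < mdeg J)%N -> exists i, (0 < J i)%N.
Proof.
move=> J0; apply/existsP; move: J0; apply: contraTT.
rewrite negb_exists => /forallP J0; rewrite -leqNgt leqn0 mdegE big1 // => i _.
by apply/eqP; rewrite -leqn0 leqNgt J0.
Qed.

Lemma mnm1_lep k (J : 'X_{1..k}) i : (0 < J i)%N -> (U_(i) <= J)%MM.
Proof. by move=> Ji; apply/mnm_lepP => j; rewrite mnm1E; case: eqVneq => // <-. Qed.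

Lemma mdeg_subm1 k (J : 'X_{1..k}) i :
  (0 < J i)%N -> mdeg J = (mdeg (J - U_(i))%MM).+1.
Proof.
move/mnm1_lep/submK => /(congr1 (@mdeg _)).
by rewrite mdegD mdeg1 addn1.
Qed.

(** The terms of the update rule depend on [K] only through |K|; this provides a [K] of any
    prescribed degree below [J]. *)
Lemma submonomial_mdeg k (J : 'X_{1..k}) l : (l <= mdeg J)%N ->
  exists2 K : 'X_{1..k}, (K <= J)%MM & mdeg K = l.
Proof.
move=> lJ; have -> : l = (mdeg J - (mdeg J - l))%N by rewrite subKn.
have : (mdeg J - l <= mdeg J)%N by rewrite leq_subr.
elim: (mdeg J - l)%N => [|j IHj] jJ; first by exists J; rewrite ?lepm_refl ?subn0.
have [K KJ KE] := IHj (ltnW jJ).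
have [|i Ki] := @mdeg_gt0_ex _ K; first by rewrite KE subn_gt0.
exists (K - U_(i))%MM.
  apply/mnm_lepP => j'; rewrite mnmBE; apply: leq_trans (leq_subr _ _) _.
  by have /mnm_lepP := KJ.
by have := mdeg_subm1 Ki; lia.
Qed.

Lemma mmap_mderiv (R : nzRingType) (S : comNzRingType) (f : {rmorphism R -> S})
    k (h : 'I_k -> S) j (P : {mpoly R[k]}) :
  mmap f h (mderiv j P) =
  \sum_(J <- msupp P) (f P@_J * mmap1 h (J - U_(j))) *+ J j.
Proof.
rewrite /mderiv raddf_sum; apply: eq_bigr => J _ /=.
by rewrite mmapZ mmapX rmorphM rmorph_nat -mulrA mulr_natl.
Qed.

Section Taylor.
Variables (R : nzRingType) (S : comNzRingType) (f : {rmorphism R -> S}) (k : nat).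
Implicit Types (P : {mpoly R[k]}) (z e : 'I_k -> S).

Definition line z e (i : 'I_k) : {poly S} := (z i)%:P + (e i)%:P * 'X.

(* The expansion of [P(z + T e)] along powers of [T]: the coefficient of [T^l]
   collects the terms [z^(J - K) e^K] with [|K| = l]. *)
Definition mmap_line z e P : {poly S} := mmap (polyC \o f) (line z e) P.

Lemma mmap_line_mderiv_coef z e j P l : (mmap_line z e (mderiv j P))`_l =
  \sum_(J <- msupp P) (f P@_J * (mmap1 (line z e) (J - U_(j)))`_l) *+ J j.
Proof.
rewrite /mmap_line (mmap_mderiv (polyC \o f)) coef_sum; apply: eq_bigr => J _.
by rewrite coefMn coefCM.
Qed.

Lemma mmap_line_horner z e P c :
  (mmap_line z e P).[c] = mmap f (fun i => z i + c * e i) P.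
Proof.
rewrite /mmap_line /mmap horner_sum; apply: eq_bigr => m _.
rewrite hornerM hornerC horner_prod; congr (_ * _); apply: eq_bigr => i _.
by rewrite horner_exp !hornerE [c * _]mulrC.
Qed.

Lemma mmap_line_coef0 z e P : (mmap_line z e P)`_0 = mmap f z P.
Proof.
rewrite -horner_coef0 mmap_line_horner; apply: eq_bigr => m _; congr (_ * _).
by apply: eq_bigr => i _; rewrite mul0r addr0.
Qed.

(** Both sides are additive and obey the Leibniz rule, so constants and variables suffice. The
    linear term is thereby the Jacobian applied to [e]. *)
Lemma mmap_line_coef1 z e P :
  (mmap_line z e P)`_1 = \sum_j mmap f z (mderiv j P) * e j.
Proof.
elim/mpoly_ring_ind: P => [c|i|p q IHp IHq|p q IHp IHq].
- rewrite /mmap_line mmapC /= coefC big1 // => j _.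
  by rewrite mderivC mmap0 mul0r.
- rewrite /mmap_line mmapX mmap1U /line coefD coefC coefMX coefC /= add0r.
  rewrite (bigD1 i) //= big1 => [|j ji].
    rewrite mderivX mnm1E eqxx scale1r mmapX.
    have -> : (U_(i) - U_(i) = 0 :> 'X_{1..k})%MM.
      by apply/mnmP => j; rewrite mnmBE subnn mnm0E.
    by rewrite mmap11 mul1r addr0.
  by rewrite mderivX mnm1E eq_sym (negPf ji) scale0r mmap0 mul0r.
- rewrite /mmap_line mmapD coefD [X in X + _]IHp [X in _ + X]IHq -big_split /=.
  by apply: eq_bigr => j _; rewrite mderivD mmapD mulrDl.
- have -> : mmap_line z e (p * q) = mmap_line z e p * mmap_line z e q.
    exact: rmorphM.
  rewrite coefM big_ord_recr big_ord1 /= IHp IHq !mmap_line_coef0.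
  rewrite mulr_sumr mulr_suml -big_split; apply: eq_bigr => j _.
  by rewrite mderivM mmapD !rmorphM /=; ring.
Qed.

Lemma mmap_line_sum z e P M : (size (mmap_line z e P) <= M)%N ->
  mmap f (fun i => z i + e i) P = \sum_(l < M) (mmap_line z e P)`_l.
Proof.
move=> pM; transitivity (mmap_line z e P).[1].
  rewrite mmap_line_horner; apply: eq_bigr => m _; congr (_ * _).
  by apply: eq_bigr => i _; rewrite mul1r.
by rewrite (horner_coef_wide _ pM); apply: eq_bigr => l _; rewrite expr1n mulr1.
Qed.

End Taylor.

(** * Graded bounds for the terms of the Taylor expansion *)

Section GradedTaylor.
Variables (Rl : realType) (F : fieldType) (v : valuation Rl F) (n k : nat).
Local Notation A := (tate v n).
Local Notation line_tate z e :=
  (mmap_line (@tate_of_mpoly _ _ v n) (fun i => z i 0) (fun i => e i 0)).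
Implicit Types (P : {mpoly {mpoly (vring v)[n]}[k]}) (z e : 'cV[A]_k).

Lemma evalS_line_sum z e P M : (size (line_tate z e P) <= M)%N ->
  evalS P (z + e) = \sum_(l < M) (line_tate z e P)`_l.
Proof.
move=> pM; transitivity
  (mmap (@tate_of_mpoly _ _ v n) (fun i => z i 0 + e i 0) P).
  apply: eq_bigr => m _; congr (_ * _); apply: eq_bigr => i _.
  by rewrite mxE.
exact: mmap_line_sum pM.
Qed.

Lemma taylor1 h z e P : (forall l, (0 < l)%N -> hset h (line_tate z e P)`_l) ->
  hset h (evalS P (z + e) - evalS P z).
Proof.
move=> hP; rewrite (evalS_line_sum (leqnSn _)) big_ord_recl.
rewrite [X in X + _ - _]mmap_line_coef0 addrC addKr.
by apply: hset_sum => i _; exact: hP.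
Qed.

Lemma taylor2 h z e P : (forall l, (1 < l)%N -> hset h (line_tate z e P)`_l) ->
  hset h (evalS P (z + e) -
          (evalS P z + \sum_j evalS (mderiv j P) z * e j 0)).
Proof.
move=> hP; rewrite (evalS_line_sum (leq_trans (leqnSn _) (leqnSn _))).
rewrite !big_ord_recl.
rewrite [X in X + _ - _]mmap_line_coef0 [X in _ + (X + _) - _]mmap_line_coef1.
rewrite opprD addrACA subrr add0r addrC addKr.
by apply: hset_sum => i _; exact: hP.
Qed.

Section Graded.
Variables (a : 'rV[Rl]_n) (B Ga b c : Rl).

(** Models a product of [m] factors z_i + T e_i: the coefficient of T^l is a sum of products of
    [m - l] entries of [z], each with bounds [B] and [b], and [l] entries of [e], each with bounds
    [Ga] and [c]. *)
Definition graded m (p : {poly A}) := forall l,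
  ((m < l)%N -> p`_l = 0) /\
  ((l <= m)%N -> hset (wheight a (B *+ (m - l) + Ga *+ l)) p`_l /\
                 Vset (b *+ (m - l) + c *+ l) p`_l).

Lemma gradedM m m' p q : graded m p -> graded m' q -> graded (m + m') (p * q).
Proof.
move=> hp hq l; split=> [ml|lm]; rewrite coefM.
  apply: big1 => -[j /= jl] _; have [mj|jm] := ltnP m j.
    by rewrite (hp j).1 ?mul0r.
  by rewrite (hq (l - j)%N).1 ?mulr0 //; lia.
(* As j <= m and l - j <= m', no subtraction truncates, and the numbers of [z] and [e] factors add
   up separately. *)
have E (x y : Rl) (j : nat) : (j < l.+1)%N -> (j <= m)%N -> (l - j <= m')%N ->
    x *+ (m + m' - l) + y *+ l =
    x *+ (m - j) + y *+ j + (x *+ (m' - (l - j)) + y *+ (l - j)).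
  move=> jl jm jm'; rewrite addrACA -!mulrnDr; congr (_ *+ _ + _ *+ _); lia.
split; apply: hset_sum => -[j /= jl] _.
  have [mj|jm] := ltnP m j; first by rewrite (hp j).1 ?mul0r //; exact: hset0.
  have [mj|jm'] := ltnP m' (l - j).
    by rewrite (hq (l - j)%N).1 ?mulr0 //; exact: hset0.
  rewrite (E B Ga j) //.
  by apply: wsetM; [exact: ((hp j).2 jm).1|exact: ((hq _).2 jm').1].
have [mj|jm] := ltnP m j; first by rewrite (hp j).1 ?mul0r //; exact: hset0.
have [mj|jm'] := ltnP m' (l - j).
  by rewrite (hq (l - j)%N).1 ?mulr0 //; exact: hset0.
rewrite (E b c j) //.
by apply: VsetM; [exact: ((hp j).2 jm).2|exact: ((hq _).2 jm').2].
Qed.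

Lemma graded1 : graded 0 1.
Proof.
move=> l; rewrite coef1; split; first by case: l.
rewrite leqn0 => /eqP->; rewrite subn0 !mulr0n addr0; split; last exact: hset_ge0.
exact/W0P/rpred1.
Qed.

Variables (z e : 'cV[A]_k).
Hypothesis zP : forall i, hset (wheight a B) (z i 0) /\ Vset b (z i 0).
Hypothesis eP : forall i, hset (wheight a Ga) (e i 0) /\ Vset c (e i 0).

Lemma graded_line i : graded 1 (line (fun i => z i 0) (fun i => e i 0) i).
Proof.
move=> l; rewrite /line coefD coefC coefMX coefC.
case: l => [|[|l]]; rewrite /= ?addr0 ?add0r ?mulr0n ?addr0 ?add0r //; by split.
Qed.

Lemma graded_mmap1 (m : 'X_{1..k}) :
  graded (mdeg m) (mmap1 (line (fun i => z i 0) (fun i => e i 0)) m).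
Proof.
rewrite mdegE /mmap1; elim/big_ind2: _ => [|p m1 q m2|i _].
- exact: graded1.
- exact: gradedM.
elim: (m i) => [|j IHj]; first by rewrite expr0; exact: graded1.
by rewrite exprS -add1n; apply: gradedM => //; exact: graded_line.
Qed.

Lemma line_tate_hset h P l :
  (forall J, J \in msupp P -> (l <= mdeg J)%N -> forall f : A,
     hset (wheight a (B *+ (mdeg J - l) + Ga *+ l)) f ->
     Vset (b *+ (mdeg J - l) + c *+ l) f -> hset h (tate_of_mpoly P@_J * f)) ->
  hset h (line_tate z e P)`_l.
Proof.
move=> hP; rewrite coef_sum big_seq; apply: hset_sum => J JP; rewrite coefCM.
have [Jl|lJ] := ltnP (mdeg J) l.
  by rewrite (graded_mmap1 J l).1 // mulr0; exact: hset0.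
by have [fW fV] := (graded_mmap1 J l).2 lJ; apply: hP.
Qed.

(** Differentiation removes one factor [z], whence |J| - l - 1, and produces the integer [J j],
    which cannot lower valuations. *)
Lemma line_tate_deriv_hset h P j l :
  (forall J, J \in msupp P -> (0 < J j)%N -> (l < mdeg J)%N -> forall f : A,
     hset (wheight a (B *+ (mdeg J - l - 1) + Ga *+ l)) f ->
     Vset (b *+ (mdeg J - l - 1) + c *+ l) f -> hset h (tate_of_mpoly P@_J * f)) ->
  hset h (line_tate z e (mderiv j P))`_l.
Proof.
move=> hP; rewrite mmap_line_mderiv_coef big_seq.
apply: hset_sum => J JP.
case: (posnP (J j)) => [->|J0]; first by rewrite mulr0n; exact: hset0.
have dJ := mdeg_subm1 J0.
rewrite -[X in _ *+ X]card_ord -sumr_const; apply: hset_sum => _ _.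
have [Jl|lJ] := ltnP (mdeg (J - U_(j))%MM) l.
  by rewrite (graded_mmap1 _ l).1 // mulr0; exact: hset0.
have [fW fV] := (graded_mmap1 _ l).2 lJ.
have E : (mdeg J - l - 1 = mdeg (J - U_(j))%MM - l)%N by lia.
by apply: hP; rewrite ?E ?dJ.
Qed.

End Graded.
End GradedTaylor.

(** * Completeness of a finite extension *)

Section Completeness.
Variable Rl : realType.

Definition vcauchy (F : fieldType) (v : valuation Rl F) (u : nat -> F) :=
  forall C : Rl, exists M, forall i j, (M <= i)%N -> (M <= j)%N ->
    (C%:E <= v (u i - u j)%R)%E.

Definition vcvg (F : fieldType) (v : valuation Rl F) (u : nat -> F) (l : F) :=
  forall C : Rl, exists M, forall i, (M <= i)%N -> (C%:E <= v (u i - l)%R)%E.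

Definition vcomplete (F : fieldType) (v : valuation Rl F) :=
  forall u, vcauchy v u -> exists l, vcvg v u l.

Lemma valuation_lower (F : fieldType) (v : valuation Rl F) x :
  exists E : Rl, (E%:E <= v x)%E.
Proof.
have := valuation_neqNy (v := v) (x := x).
by case: (v x) => [r| |] // _; [exists r|exists 0; rewrite leey].
Qed.

Lemma valuation_eq0 (F : fieldType) (v : valuation Rl F) x :
  (forall C : Rl, (C%:E <= v x)%E) -> x = 0.
Proof.
move=> vx; apply/(valuation_eqy v); case: (v x) vx => [r| |] // vx.
  by exfalso; have := vx (r + 1)%R; rewrite lee_fin; lra.
by have := vx 0.
Qed.

Variables (Qp : fieldType) (w : valuation Rl Qp).
Hypothesis w_complete : vcomplete w.
Variables (K : fieldExtType Qp) (v : valuation Rl K).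
Hypothesis v_ext : forall a : Qp, v a%:A = w a.

Lemma valuationZ a x : v (a *: x) = (w a + v x)%E.
Proof. by rewrite -mulr_algl valuationM v_ext. Qed.

Lemma vcvg_sum m (e : 'I_m -> K) (a : nat -> 'I_m -> Qp) (b : 'I_m -> Qp) :
  (forall i, vcvg w (fun k => a k i) (b i)) ->
  vcvg v (fun k => \sum_i a k i *: e i) (\sum_i b i *: e i).
Proof.
move=> ab C.
have /fin_all_exists[M MP] i : exists M, forall k, (M <= k)%N ->
    (C%:E <= v ((a k i - b i) *: e i)%R)%E.
  have [E eE] := valuation_lower v (e i); have [M MP] := ab i (C - E).
  exists M => k /MP; rewrite valuationZ => abk.
  by apply: le_trans (leeD abk eE); rewrite -EFinD subrK.
exists (\max_i M i) => k /bigmax_leqP Mk.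
rewrite -sumrB; apply: valuation_le_sum => i _.
by rewrite -scalerBl; apply: MP; exact: Mk.
Qed.

(* Equivalence of norms on a finite-dimensional space over a complete field. *)
Lemma coord_bound m (e : 'I_m -> K) :
  (forall a : 'I_m -> Qp, \sum_i a i *: e i = 0 -> forall i, a i = 0) ->
  exists C : Rl, forall (a : 'I_m -> Qp) (t : Rl),
    (t%:E <= v (\sum_i a i *: e i)%R)%E -> forall i, ((t - C)%:E <= w (a i))%E.
Proof.
elim: m e => [|m IHm] e e_free; first by exists 0 => a t _ [].
pose ext (x : Qp) (a : 'I_m -> Qp) i := oapp a x (unlift ord0 i).
have extE x a : \sum_i ext x a i *: e i =
    x *: e ord0 + \sum_i a i *: e (lift ord0 i).
  rewrite big_ord_recl /ext unlift_none; congr (_ + _).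
  by apply: eq_bigr => i _; rewrite liftK.
have [|C' C'P] := IHm (fun i => e (lift ord0 i)).
  move=> a a0 i; have := e_free (ext 0 a) _ (lift ord0 i).
  by rewrite extE scale0r add0r /ext liftK; apply.
(* [e ord0] keeps its distance from the span of the other vectors. Otherwise the span approximates
   [- e ord0]; the coordinates are Cauchy by induction, and their limits give a linear relation with
   first coefficient 1. *)
have [C0 C0P] : exists C0 : Rl, forall a : 'I_m -> Qp,
    ~ (C0%:E <= v (e ord0 + \sum_i a i *: e (lift ord0 i))%R)%E.
  apply: contrapT => /forallNP H.
  have {H} /choice[a aP] (k : nat) : exists a : 'I_m -> Qp,
      (k%:R%:E <= v (e ord0 + \sum_i a i *: e (lift ord0 i))%R)%E.
    by apply: contrapT => /forallNP; exact: H.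
  have aC i : vcauchy w (fun k => a k i).
    move=> C; pose M := Num.bound (C + C').
    have MC k : (M <= k)%N -> ((C + C')%:E <= k%:R%:E)%E.
      by move=> Mk; rewrite lee_fin le_archi_bound.
    exists M => k l Mk Ml; rewrite -[C](addrK C').
    apply: (C'P (fun i => a k i - a l i)).
    under eq_bigr do rewrite scalerBl.
    rewrite sumrB -(addrKA (e ord0)) [_ + e ord0]addrC.
    apply: valuation_leD; rewrite ?valuationN.
      exact: le_trans (MC _ Mk) (aP k).
    exact: le_trans (MC _ Ml) (aP l).
  have /choice[b bP] i := w_complete (aC i).
  have /e_free/(_ ord0)/eqP : \sum_i ext 1 b i *: e i = 0.
    apply: (valuation_eq0 (v := v)) => C.
    have [M MP] := vcvg_sum (fun i => e (lift ord0 i)) bP C.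
    pose k := maxn M (Num.bound C).
    have -> : \sum_i ext 1 b i *: e i =
        (e ord0 + \sum_i a k i *: e (lift ord0 i)) -
        (\sum_i a k i *: e (lift ord0 i) - \sum_i b i *: e (lift ord0 i)).
      by rewrite extE scale1r opprB addrA addrAC addrK.
    apply: valuation_leD.
      apply: le_trans (aP k); rewrite lee_fin.
      exact/le_archi_bound/leq_maxr.
    by rewrite valuationN; apply: MP; exact: leq_maxl.
  by rewrite /ext unlift_none oner_eq0.
have [E0 E0P] := valuation_lower v (e ord0).
(* Dividing by a nonzero first coordinate gives [e ord0] plus an element of the span, whose
   valuation is below [C0]. *)
have a0P a t : (t%:E <= v (\sum_i a i *: e i)%R)%E ->
    ((t - C0)%:E <= w (a ord0))%E.
  rewrite big_ord_recl => ta; have [->|a0] := eqVneq (a ord0) 0.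
    by rewrite valuation0 leey.
  rewrite leNgt; apply/negP => wa.
  apply: (C0P (fun i => (a ord0)^-1 * a (lift ord0 i))).
  have -> : e ord0 + \sum_i ((a ord0)^-1 * a (lift ord0 i)) *: e (lift ord0 i) =
      (a ord0)^-1 *: (a ord0 *: e ord0 + \sum_i a (lift ord0 i) *: e (lift ord0 i)).
    rewrite scalerDr scalerA mulVf // scale1r scaler_sumr; congr (_ + _).
    by apply: eq_bigr => i _; rewrite scalerA.
  rewrite valuationZ.
  have := valuationM w (a ord0) (a ord0)^-1; rewrite divff // valuation1.
  have := valuation_neqNy (v := w) (x := a ord0).
  case: (w (a ord0)) wa => [r| |] //; rewrite lte_fin => rt _.
  case: (w (a ord0)^-1) => [r'| |] // /eqP; rewrite -EFinD eqe => rr.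
  by apply: le_trans (leeD (lexx _) ta); rewrite -EFinD lee_fin; lra.
(* [C0] serves the first coordinate. For the others, removing [a ord0 *: e ord0] costs at most
   [Num.max 0 (C0 - E0)] and the induction hypothesis costs [C']. *)
exists (Num.max C0 (C' + Num.max 0 (C0 - E0))) => a t ta i.
have a0 := a0P _ _ ta; have [j ->|->] := unliftP ord0 i; last first.
  by apply: le_trans a0; rewrite lee_fin lerD2l lerN2 le_max lexx.
set C1 := Num.max 0 _; apply: (@le_trans _ _ (t - C1 - C')%:E).
  rewrite lee_fin -addrA -opprD lerD2l lerN2 [C1 + _]addrC.
  by rewrite le_max lexx orbT.
apply: (C'P (fun j => a (lift ord0 j))).
have -> : \sum_i a (lift ord0 i) *: e (lift ord0 i) =
    \sum_i a i *: e i - a ord0 *: e ord0.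
  by rewrite big_ord_recl addrC addKr.
have [C1t C1e] : t - C1 <= t /\ t - C1 <= t - C0 + E0.
  have : 0 <= C1 /\ C0 - E0 <= C1 by rewrite /C1 !le_max !lexx orbT.
  by split; lra.
apply: valuation_leD; first by apply: le_trans ta; rewrite lee_fin.
rewrite valuationN valuationZ; apply: le_trans (leeD a0 E0P).
by rewrite -EFinD lee_fin.
Qed.

(** By [coord_bound] a Cauchy sequence has Cauchy coordinates in a basis; their limits recombine to
    the limit. *)
Lemma fieldExt_complete : vcomplete v.
Proof.
move=> u u_cauchy; pose X := vbasis {:K}%VS.
have Xfree (a : 'I_(\dim {:K}) -> Qp) :
    \sum_i a i *: X`_i = 0 -> forall i, a i = 0.
  by have /freeP := basis_free (vbasisP {:K}%VS); apply.
have uE k : u k = \sum_i coord X i (u k) *: X`_i.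
  by apply: coord_vbasis; exact: memvf.
have [C CP] := coord_bound Xfree.
have /choice[b bP] i : exists b, vcvg w (fun k => coord X i (u k)) b.
  apply: w_complete => t; have [M MP] := u_cauchy (t + C).
  exists M => k l Mk Ml; rewrite -[t](addrK C).
  apply: (CP (fun i => coord X i (u k) - coord X i (u l))).
  under eq_bigr do rewrite scalerBl.
  by rewrite sumrB -!uE; apply: MP.
exists (\sum_i b i *: X`_i) => t.
have [M MP] := vcvg_sum (fun i => X`_i) bP t.
by exists M => k /MP; rewrite -uE.
Qed.

End Completeness.

(** * One Newton step *)

Section Bounds.
Variables (Rl : realType) (n k N : nat).
Variable delta : 'I_k -> 'X_{1..k} -> 'rV[Rl]_n.
Implicit Types (d : newton_data Rl n) (J K : 'X_{1..k}).

(* Numerator and denominator of the quotients in [update_lambda], with [s]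
   and [l] the numbers of factors [z] and [epsilon] in the corresponding term. *)
Definition lambda_num d i J s l : Rl := dot (invv (nalpha d)) (delta i J) +
  dot (invv (nalpha d)) (nbeta d) *+ s + dot (invv (nalpha d)) (ngamma d) *+ l.
Definition lambda_den d s l : Rl := nb d *+ s + nc d *+ l.

Lemma lambda_den_gt0 d s l :
  0 < nb d -> 0 < nc d -> (0 < l)%N -> 0 < lambda_den d s l.
Proof.
by move=> b0 c0 l0; rewrite ltr_wpDl ?pmulrn_lgt0 // mulrn_wge0 // ltW.
Qed.

Lemma dot_lambda_num d i J s l : dot (invv (nalpha d))
  (delta i J + nbeta d *+ s + ngamma d *+ l) = lambda_num d i J s l.
Proof. by rewrite !dotD !dotMn. Qed.

(** Some [j] occurs in [J], and l < |J| leaves room for a [K] of degree [l] below J - U_j, so the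
    quotient for [l] occurs in the maximum. *)
Lemma update_lambda_ge d i J l : 0 < nb d -> 0 < nc d ->
  (mdeg J <= N)%N -> (0 < l < mdeg J)%N ->
  lambda_num d i J (mdeg J - l - 1) l <=
    update_lambda N delta d * lambda_den d (mdeg J - l - 1) l.
Proof.
move=> b0 c0 JN /andP[l0 lJ].
have [|j Jj] := @mdeg_gt0_ex _ J; first by lia.
have UJ := mnm1_lep Jj; have dJ := mdeg_subm1 Jj.
have [|K KJ Kl] := @submonomial_mdeg _ (J - U_(j))%MM l; first by lia.
have JN1 : (mdeg J < N.+1)%N by [].
have KN1 : (mdeg K < N.+1)%N by lia.
rewrite -ler_pdivrMr ?lambda_den_gt0 // /update_lambda.
apply: (bigmax_sup i) => //; apply: (bigmax_sup j) => //.
apply: (bigmax_sup (BMultinom JN1)); first by rewrite /=; lia.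
apply: (bigmax_sup (BMultinom KN1)) => /=; last by rewrite Kl dot_lambda_num.
rewrite -mdeg_eq0 Kl -lt0n l0; apply/mnm_lepP => j'; rewrite mnmDE.
have /mnm_lepP/(_ j') := KJ; have /mnm_lepP/(_ j') := UJ; rewrite mnmBE.
by lia.
Qed.

Lemma update_lambda_le d x : 0 < nb d -> 0 < nc d -> 0 <= x ->
  (forall i J l, (2 <= mdeg J)%N -> (mdeg J <= N)%N -> (0 < l < mdeg J)%N ->
     lambda_num d i J (mdeg J - l - 1) l <= x * lambda_den d (mdeg J - l - 1) l) ->
  update_lambda N delta d <= x.
Proof.
move=> b0 c0 x0 H; rewrite /update_lambda.
apply: bigmax_le => // i _; apply: bigmax_le => // j _.
apply: bigmax_le => // J J2; apply: bigmax_le => // K /andP[K0 KJ].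
have JN : (mdeg J <= N)%N by rewrite -ltnS bmdeg.
have lJ : (0 < mdeg K < mdeg J)%N.
  rewrite lt0n mdeg_eq0 K0 /=; have := submK KJ => /(congr1 (@mdeg _)).
  by rewrite !mdegD mdeg1; lia.
by rewrite dot_lambda_num ler_pdivrMr ?lambda_den_gt0 ?H //; case/andP: lJ.
Qed.

Lemma update_gamma_ge d i J l t : update_gamma N delta d = t%:E ->
  (mdeg J <= N)%N -> (1 < l <= mdeg J)%N ->
  lambda_num d i J (mdeg J - l) l -
    update_lambda N delta d * lambda_den d (mdeg J - l) l <= t.
Proof.
move=> gE JN /andP[l0 lJ].
have [K KJ Kl] := submonomial_mdeg lJ.
have JN1 : (mdeg J < N.+1)%N by [].
have KN1 : (mdeg K < N.+1)%N by lia.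
rewrite -lee_fin -gE /update_gamma.
apply: (bigmax_sup i) => //.
apply: (bigmax_sup (BMultinom JN1)); first by rewrite /=; lia.
apply: (bigmax_sup (BMultinom KN1)) => /=; first by rewrite Kl l0.
by rewrite Kl dot_lambda_num.
Qed.

Lemma update_gamma_le d x t : update_gamma N delta d = t%:E ->
  (forall i J l, (mdeg J <= N)%N -> (1 < l <= mdeg J)%N ->
     lambda_num d i J (mdeg J - l) l -
       update_lambda N delta d * lambda_den d (mdeg J - l) l <= x) -> t <= x.
Proof.
move=> gE H; rewrite -lee_fin -gE /update_gamma.
apply: bigmax_le => [|i _]; first exact: leNye.
apply: bigmax_le => [|J J2]; first exact: leNye.
apply: bigmax_le => [|K /andP[K2 KJ]]; first exact: leNye.
rewrite dot_lambda_num lee_fin; apply: H; first by rewrite -ltnS bmdeg.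
rewrite K2; have := submK KJ => /(congr1 (@mdeg _)).
by rewrite mdegD => <-; rewrite leq_addl.
Qed.

(* Taking one factor [epsilon] off a term of [update_gamma] gives a term of
   [update_lambda]. *)
Lemma update_gammaP d t : update_gamma N delta d = t%:E ->
  0 < nb d -> 0 < nc d ->
  t <= dot (invv (nalpha d)) (ngamma d) - update_lambda N delta d * nc d.
Proof.
move=> gE b0 c0; apply: (update_gamma_le gE) => i J l JN /andP[l2 lJ].
have := @update_lambda_ge d i J l.-1 b0 c0 JN; rewrite /lambda_num /lambda_den.
have -> : (mdeg J - l.-1 - 1 = mdeg J - l)%N by lia.
have [-> ->] : dot (invv (nalpha d)) (ngamma d) *+ l =
    dot (invv (nalpha d)) (ngamma d) + dot (invv (nalpha d)) (ngamma d) *+ l.-1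
    /\ nc d *+ l = nc d + nc d *+ l.-1.
  by rewrite -!mulrS prednK //; lia.
have l1 : (0 < l.-1 < mdeg J)%N by lia.
by move=> /(_ l1); lra.
Qed.

End Bounds.

Section Step.
Variables (Rl : realType) (F : fieldType) (v : valuation Rl F) (n k N : nat).
Variable G : 'I_k -> {mpoly {mpoly (vring v)[n]}[k]}.
Hypothesis G_deg : forall j (J : 'X_{1..k}), (N < mdeg J)%N -> (G j)@_J = 0.
Variable delta : 'I_k -> 'X_{1..k} -> 'rV[Rl]_n.
Implicit Types (d : newton_data Rl n) (z e : 'cV[tate v n]_k).

Definition delta_bound (a : 'rV[Rl]_n) := forall i (J : 'X_{1..k}),
  (2 <= mdeg J)%N -> Wset a (delta i J) (tate_of_mpoly (G i)@_J).

Definition newton_incr z := - (invmx (JacG G z) *m evalG G z).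

Lemma newtonS z m :
  newton G z m.+1 = newton G z m + newton_incr (newton G z m).
Proof. by []. Qed.

Lemma msupp_deg i J : J \in msupp (G i) -> (mdeg J <= N)%N.
Proof.
by rewrite leqNgt; apply: contraL => /G_deg GJ; rewrite -mcoeff_eq0 GJ.
Qed.

Lemma JacG_unit d z : admissible G d z -> JacG G z \in unitmx.
Proof.
by case=> _ _ _ [_ [_ [u _ Du]]] _; rewrite unitmxE; apply/unitrPr; exists u.
Qed.

(** The linear Taylor polynomial of [G] at [z] vanishes at the increment, so after the step only
    terms of order at least 2 remain in [G]. *)
Lemma JacG_newton_incr z : JacG G z \in unitmx ->
  forall i, evalS (G i) z + \sum_j evalS (mderiv j (G i)) z * newton_incr z j 0 = 0.
Proof.
move=> Ju i.
have : JacG G z *m newton_incr z = - evalG G z by rewrite mulmxN mulKVmx.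
move/matrixP/(_ i 0); rewrite !mxE => /eqP; rewrite -addr_eq0 addrC => /eqP E.
rewrite -[RHS]E; congr (_ + _); apply: eq_bigr => j _; by rewrite [JacG _ _ _ _]mxE.
Qed.

(** The inverse Jacobian has entries in W(alpha, 0), so the increment inherits the bounds gamma and
    c of G(z). *)
Lemma newton_incr_bound d z : admissible G d z -> forall i,
  hset (wheight (nalpha d) (dot (invv (nalpha d)) (ngamma d))) (newton_incr z i 0)
  /\ Vset (nc d) (newton_incr z i 0).
Proof.
case=> _ _ Gz [Jz [_ [u uW Du]]] _ i.
have JW p q : JacG G z p q \in W0 (nalpha d) by apply/Wset0E.
have invW := W0_invmx JW (iffLR (Wset0E _ _) uW) Du.
have E : newton_incr z i 0 = - \sum_j invmx (JacG G z) i j * evalG G z j 0.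
  by rewrite /newton_incr [LHS]mxE [X in - X]mxE.
rewrite E; split; apply: hsetN; apply: hset_sum => j _.
  rewrite -[dot _ _]add0r; apply: wsetM; first exact/W0P/invW.
  by apply/WsetE; exact: (Gz j).1.
by apply: VsetMl; exact: (Gz j).2.
Qed.

Lemma W0_scale (a : 'rV[Rl]_n) l (f : tate v n) : 0 <= l ->
  f \in W0 a -> f \in W0 ((1 + l) *: a).
Proof.
move=> l0 /Wset0E fW; apply/Wset0E; have l1 : 1 <= 1 + l by lra.
by apply: (Wset_weaken ltr01 l1 (lexx _)); rewrite scale1r.
Qed.

Lemma newton_step d d' z : admissible G d z -> delta_bound (nalpha d) ->
  newton_update N delta d d' ->
  admissible G d' (z + newton_incr z) /\ delta_bound (nalpha d').
Proof.
move=> adm dG [bE cE aE BE GE].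
have eP := newton_incr_bound adm.
have Je := JacG_newton_incr (JacG_unit adm); set e := newton_incr z in eP Je *.
have [[a0 b0 c0] zP _ [Jz [_ [u uW Du]]] GB] := adm.
set l := update_lambda N delta d in aE BE GE.
have l0 : 0 <= l by exact: update_lambda_ge0.
pose B := dot (invv (nalpha d)) (nbeta d).
pose Ga := dot (invv (nalpha d)) (ngamma d).
have zP' i : hset (wheight (nalpha d) B) (z i 0) /\ Vset (nb d) (z i 0).
  by have [zW zV] := zP i; split=> //; apply/WsetE.
have GJ i J s m f : (2 <= mdeg J)%N ->
    hset (wheight (nalpha d) (B *+ s + Ga *+ m)) f -> Vset (lambda_den d s m) f ->
    hset (wheight (nalpha d) (lambda_num delta d i J s m)) (tate_of_mpoly (G i)@_J * f)
    /\ Vset (lambda_den d s m) (tate_of_mpoly (G i)@_J * f).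
  move=> J2 fW fV; split; last exact: VsetMl.
  by rewrite /lambda_num -addrA; apply: wsetM => //; apply/WsetE; exact: dG.
(* The increment lies in V(c), so the Jacobian is unchanged modulo V(c); this keeps the constant
   term of its determinant a unit. *)
have dJ i j : Vset (nc d) (JacG G (z + e) i j - JacG G z i j).
  rewrite !mxE; apply: cong_evalS => p; rewrite mxE [_ + e p 0]addrC addrK.
  exact: (eP p).2.
have JW i j : JacG G (z + e) i j \in W0 (nalpha d').
  rewrite -[JacG _ _ _ _](subrK (JacG G z i j)) rpredD //; last first.
    by rewrite aE; apply: W0_scale => //; apply/Wset0E.
  apply/Wset0E; rewrite !mxE; apply/WsetE; apply: taylor1 => m m0.
  apply: (line_tate_deriv_hset zP' eP) => J JG Jj mJ f fW fV; apply/WsetE.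
  have J2 : (2 <= mdeg J)%N by lia.
  have [gW gV] := GJ i J _ _ f J2 fW fV.
  (* For target shift 0 the requirement reads: numerator at most lambda times denominator. *)
  rewrite aE; apply: (Wset_scale l0 gW gV); rewrite dot0 subr_le0.
  by apply: update_lambda_ge => //; [exact: msupp_deg JG|rewrite m0].
have detW := W0_det JW.
have detV : v (\det (JacG G (z + e)) 0%MM) = 0%E.
  by apply: val0_cong c0 (cong_det dJ) (unit_val0 Du).
have a'0 i : 0 < nalpha d' 0 i by rewrite aE mxE mulr_gt0 //; lra.
have b'c : nb d' <= nc d by rewrite bE ge_min lexx orbT.
have b'b : nb d' <= nb d by rewrite bE ge_min lexx.
split; last first.
  move=> i J J2; rewrite aE; apply: (Wset_weaken ltr01 _ (lexx _)); first by lra.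
  by rewrite scale1r; exact: dG.
split.
- split=> //; first by rewrite bE lt_min b0.
  by rewrite cE mulr_gt0.
- move=> i; rewrite mxE.
  have zV : Vset (nb d') (z i 0 + e i 0).
    by apply: hsetD; [apply: hset_le (zP' i).2|apply: hset_le (eP i).2].
  (* As gamma <= beta after pairing with alpha^-1, [z] and the increment share the bound [B]; both
     lie in V(b'), and scaling gives beta'. *)
  split=> //; rewrite aE; apply: (@Wset_scale _ _ _ _ _ _ B l (nb d')) => //.
    apply: hsetD; first exact: (zP' i).1.
    by apply: hset_le (eP i).1 => D; rewrite /wheight lerD2l lerN2.
  by rewrite BE.
- move=> i; rewrite mxE; split.
    apply/WsetE; rewrite -[evalS _ _]subr0 -(Je i); apply: taylor2 => m m1.
    apply: (line_tate_hset zP' eP) => J JG mJ f fW fV; apply/WsetE.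
    have J2 : (2 <= mdeg J)%N by lia.
    have [gW gV] := GJ i J _ _ f J2 fW fV.
    rewrite aE; apply: (Wset_scale l0 gW gV).
    by apply: (update_gamma_ge i (esym GE)); [exact: msupp_deg JG|rewrite m1].
  rewrite -[evalS _ _]subr0 -(Je i); apply: (taylor2 (h := fun=> nc d')) => m m1.
  apply: (line_tate_hset zP' eP) => J JG mJ f fW fV.
  apply: VsetMl; apply: hset_le fV => _; rewrite cE.
  (* At least two factors come from the increment, which gives c' = c + c. *)
  have -> : m = (m - 2).+2 by lia.
  rewrite !mulrS; have : 0 <= nb d *+ (mdeg J - (m - 2).+2) + nc d *+ (m - 2).
    by rewrite addr_ge0 // mulrn_wge0 // ltW.
  by lra.
- split=> [i j|]; first exact/Wset0E.
  split; first exact/Wset0E.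
  have [u' u'W Du'] := W0_unit a'0 detW detV.
  by exists u' => //; apply/Wset0E.
(* Paired with alpha^-1: gamma' <= gamma - lambda c <= beta - lambda b' = beta'. *)
have := update_gammaP (esym GE) b0 c0; rewrite -/l aE !dot_invvZ BE => gle.
have l1 : 0 <= (1 + l)^-1 by rewrite invr_ge0; lra.
by apply: (ler_wpM2l l1); have := ler_wpM2l l0 b'c; lra.
Qed.

End Step.

(** * Limits and uniqueness *)

Section Limit.
Variables (Rl : realType) (F : fieldType) (v : valuation Rl F) (n k : nat).

(** The rates [c m] are uniform in [D], so the coefficientwise limit inherits integrality and decay
    from an approximant. *)
Lemma tate_limit (u : nat -> tate v n) (c : nat -> Rl) : vcomplete v ->
  (forall m j, (m <= j)%N -> Vset (c m) (u j - u m)) ->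
  (forall C, exists m, C <= c m) ->
  exists s : tate v n, forall m, Vset (c m) (s - u m).
Proof.
move=> v_complete uc c_oo.
have uF i j D : (u i D : F) - (u j D : F) = (u i - u j) D :> F by [].
have /choice[l lP] D : exists l, vcvg v (fun m => u m D : F) l.
  apply: v_complete => C; have [m Cm] := c_oo C; exists m => i j mi mj.
  rewrite (uF i j D); suff : Vset C (u i - u j) by exact.
  rewrite -(subrKA (u m)) -[u m - u j]opprB.
  by apply: hsetB; [apply: hset_le (uc m i mi)|apply: hset_le (uc m j mj)].
have luP m D : ((c m)%:E <= v (l D - (u m D : F))%R)%E.
  have [M MP] := lP D (c m).
  have -> : l D - (u m D : F) =
      - ((u (maxn M m) D : F) - l D) + ((u (maxn M m) - u m) D : F).
    by rewrite -(uF (maxn M m) m D) opprB addrA subrK.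
  apply: valuation_leD; first by rewrite valuationN MP ?leq_maxl.
  exact/uc/leq_maxr.
have l0 D : (0 <= v (l D))%E.
  have [m m0] := c_oo 0; rewrite -[l D](subrK (u m D : F)).
  apply: valuation_leD (vring_ge0 _); apply: le_trans (luP m D).
  by rewrite lee_fin.
pose sf : mfps (vring v) n := fun D => Vring (l0 D : l D \in vring_pred v).
have sP : sf \in tate_pred (v := v) (n := n).
  apply/asboolP => C; have [m Cm] := c_oo C.
  have /asboolP/(_ C)[M MP] := valP (u m); exists M => D DM.
  have -> : (sf D : F) = (l D - (u m D : F)) + (u m D : F) by rewrite subrK.
  apply: valuation_leD; last exact: MP.
  by apply: le_trans (luP m D); rewrite lee_fin.
by exists (Tate sP) => m D; exact: luP.
Qed.

Lemma Wset_eq (a x y : 'rV[Rl]_n) (f : tate v n) :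
  dot (invv a) x = dot (invv a) y -> Wset a x f -> Wset a y f.
Proof. by move=> xy /WsetE fW; apply/WsetE; rewrite -xy. Qed.

Variables (pi : vring v) (pi_unif : uniformiser pi).

Lemma uniformiser_gt0 : (0 < v pi)%E.
Proof. by apply/pi_unif; exists 1; rewrite mulr1. Qed.

Lemma in_pi_dagger_Vset : exists2 c : Rl, 0 < c &
  forall f : tate v n, in_pi_dagger pi f -> Vset c f.
Proof.
have := uniformiser_gt0; case pE: (v pi) => [r| |] // r0.
  exists r => // f [g _ fg] D; rewrite fg valuationM pE.
  by apply: leeDl; exact: vring_ge0.
exists 1 => // f [g _ fg] D; rewrite fg valuationM pE addye ?leey //.
exact/eqP/valuation_neqNy.
Qed.

(** Positive valuation makes every coefficient divisible by [pi]; for finite [v pi], division lowers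
    the linear bound coming from [W] only by that constant. *)
Lemma Wset_in_pi_dagger (a x : 'rV[Rl]_n) (c : Rl) (f : tate v n) :
  (forall i, 0 < a 0 i) -> 0 < c -> Wset a x f -> Vset c f -> in_pi_dagger pi f.
Proof.
move=> a0 c0 /WsetE fW fV.
have /choice[g gP] D : exists y, f D = pi * y.
  by apply/pi_unif; apply: lt_le_trans (fV D); rewrite lte_fin.
have [e e0 eP] := dot_expv_ge a0.
have := uniformiser_gt0; case pE: (v pi) => [r| |] // r0; last first.
  have pi0 : pi = 0 by apply/val_inj/(valuation_eqy v).
  exists 0 => [|D]; last by rewrite gP pi0 !mul0r.
  by exists 1, 0; split=> // D; rewrite tate_coef0 valuation0 leey.
pose d := - dot (invv a) x - r.
have gD D : ((e * (mdeg D)%:R + d)%:E <= v (g D))%E.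
  have := fW D; rewrite gP valuationM pE.
  have := vring_ge0 (g D); case: (v (g D)) => [t| |] //; last by rewrite !leey.
  rewrite -EFinD !lee_fin /wheight /d => _; have := eP D; lra.
have gT : g \in tate_pred (v := v) (n := n).
  apply/asboolP => C; exists (Num.bound ((C - d) / e)) => D DC.
  apply: le_trans (gD D); rewrite lee_fin -lerBlDr mulrC -ler_pdivrMr //.
  exact: le_archi_bound.
by exists (Tate gT) => //; exists e, d.
Qed.

Variable G : 'I_k -> {mpoly {mpoly (vring v)[n]}[k]}.

(* One step of a bootstrap: the difference of two solutions is killed by
   [Jac_G(z)] up to terms that are smaller by [c] or quadratic. *)
Lemma solution_step (z s s' : 'cV[tate v n]_k) (c x y : Rl) : JacG G z \in unitmx ->
  (forall i, Vset c (s i 0 - z i 0)) -> (forall i, Vset x (s' i 0 - s i 0)) ->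
  evalG G s = 0 -> evalG G s' = 0 -> 0 <= x -> y <= x + c -> y <= x + x ->
  forall i, Vset y (s' i 0 - s i 0).
Proof.
move=> Jz sz ss Gs Gs' x0 yxc yxx.
pose h := s' - s; have hE i : h i 0 = s' i 0 - s i 0 by rewrite !mxE.
have GE t i : evalG G t = 0 -> evalS (G i) t = 0.
  by move=> /matrixP/(_ i 0); rewrite !mxE.
have Jh i : Vset y ((JacG G z *m h) i 0).
  have J1 : Vset y (\sum_j evalS (mderiv j (G i)) s * h j 0).
    (* Since [G] vanishes at [s] and [s + h], minus the linear term in [h] is the Taylor
       remainder. *)
    rewrite -[X in Vset _ X]opprK; apply: hsetN.
    rewrite -[X in hset _ (- X)]add0r -[X in hset _ (- (X + _))](GE s i Gs).
    rewrite -[X in hset _ X]add0r -[X in hset _ (X - _)](GE s' i Gs').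
    have -> : s' = s + h by rewrite addrC subrK.
    apply: taylor2 => l l1.
    (* The inverse of weight 0 is 0, so the W conditions only express integrality; the V bounds are
       0 for [s] and [x] for [h]. *)
    apply: (@line_tate_hset _ _ _ _ _ 0 0 0 0 x) => [j|j|J _ lJ f _ fV].
    - split; last exact: hset_ge0.
      apply: hset_le (hset_ge0 _) => D; rewrite /wheight subr0 /dot big1 // => q _.
      by rewrite !mxE invr0 mul0r.
    - split; last by rewrite hE.
      apply: hset_le (hset_ge0 _) => D; rewrite /wheight subr0 /dot big1 // => q _.
      by rewrite !mxE invr0 mul0r.
    apply: VsetMl; apply: hset_le fV => _; rewrite mul0rn add0r.
    have -> : l = (l - 2).+2 by lia.
    rewrite !mulrS; have : 0 <= x *+ (l - 2) by rewrite mulrn_wge0.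
    by lra.
  (* Passing from the Jacobian at [s] to that at [z] introduces an error in V(x + c). *)
  have -> : (JacG G z *m h) i 0 = \sum_j evalS (mderiv j (G i)) s * h j 0 -
      \sum_j (evalS (mderiv j (G i)) s - evalS (mderiv j (G i)) z) * h j 0.
    rewrite -sumrB mxE; apply: eq_bigr => j _.
    by rewrite [JacG _ _ _ _]mxE -mulrBl opprB addrC subrK.
  apply: hsetB => //; apply: hset_sum => j _; rewrite mulrC.
  apply: (@hset_le _ _ _ _ (fun=> x + c)) => //.
  by apply: VsetM; [rewrite hE; exact: ss|exact: cong_evalS].
move=> i; rewrite -hE -[h](mulKmx Jz) mxE; apply: hset_sum => j _.
by apply: VsetMl.
Qed.

Lemma solution_unique (z s s' : 'cV[tate v n]_k) (c e : Rl) :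
  JacG G z \in unitmx -> 0 < c -> 0 < e ->
  (forall i, Vset c (s i 0 - z i 0)) -> (forall i, Vset e (s' i 0 - s i 0)) ->
  evalG G s = 0 -> evalG G s' = 0 -> s' = s.
Proof.
move=> Jz c0 e0 sz ss Gs Gs'; apply/matrixP => i j; rewrite ord1.
pose y := Num.min c e; have y0 : 0 < y by rewrite lt_min c0.
have yc : y <= c by rewrite ge_min lexx.
have ye : y <= e by rewrite ge_min lexx orbT.
(* Both [c] and the current bound, which is at least [e], are at least [y]; hence every bootstrap
   step gains [y]. *)
have sm (m : nat) : forall i, Vset (e + y *+ m) (s' i 0 - s i 0).
  elim: m => [|m IHm]; first by rewrite addr0.
  have : 0 <= y *+ m by rewrite mulrn_wge0 // ltW.
  by rewrite mulrSr => ym; apply: (solution_step Jz sz IHm) => //; lra.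
apply: VsetP => C; apply: hset_le (sm (Num.bound (C / y)) i) => _.
rewrite -mulr_natl.
have : C <= (Num.bound (C / y))%:R * y by rewrite -ler_pdivrMr // le_archi_bound.
by lra.
Qed.

End Limit.

(** * Iterating the update rule *)

Section Trajectory.
Variables (Rl : realType) (n k N : nat).
Variable delta : 'I_k -> 'X_{1..k} -> 'rV[Rl]_n.
Implicit Types d : newton_data Rl n.
Local Notation dotb d := (dot (invv (nalpha d)) (nbeta d)).
Local Notation dotg d := (dot (invv (nalpha d)) (ngamma d)).

(** Since b <= c, beta drops by lambda b and gamma by at least lambda c. Up to the factor (1 +
    lambda)^-1, each new numerator is at most the old one minus lambda times the old denominator,
    hence nonpositive. *)
Lemma update_lambda_stable d d' : newton_update N delta d d' ->
  0 < nb d -> 0 < nc d -> nb d <= nc d -> update_lambda N delta d' = 0.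
Proof.
case=> bE cE aE BE GE b0 c0 bc.
have gle := update_gammaP (esym GE) b0 c0.
have l0 := update_lambda_ge0 N delta d.
set l := update_lambda N delta d in aE BE gle l0.
have b'E : nb d' = nb d by rewrite bE; apply/min_idPl.
apply/eqP; rewrite eq_le update_lambda_ge0 andbT.
apply: update_lambda_le; rewrite ?b'E ?cE ?mulr_gt0 // => i J m J2 JN mJ.
rewrite mul0r /lambda_num aE !dot_invvZ BE b'E -!mulrnAr -!mulrDr.
rewrite pmulr_rle0; last first.
  by rewrite invr_gt0; lra.
have := update_lambda_ge delta i b0 c0 JN mJ; rewrite /lambda_num /lambda_den -/l.
set s := (mdeg J - m - 1)%N.
have := ler_wMn2r m gle; rewrite !mulrnBl -!mulrnAr mulrDr.
by lra.
Qed.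

(** Replacing gamma by the larger beta bounds every numerator by [M]; the denominator is at least c
    because |K| >= 1. *)
Lemma update_lambda_le_div d M : 0 < nb d -> 0 < nc d -> 0 <= M ->
  dotg d <= dotb d ->
  (forall i J, (2 <= mdeg J)%N -> (mdeg J <= N)%N ->
     dot (invv (nalpha d)) (delta i J) + dotb d *+ (mdeg J - 1) <= M) ->
  update_lambda N delta d <= M / nc d.
Proof.
move=> b0 c0 M0 gb HM; apply: update_lambda_le => //; first by rewrite divr_ge0 // ltW.
move=> i J m J2 JN /andP[m0 mJ].
apply: (@le_trans _ _ M).
  apply: le_trans (HM i J J2 JN); rewrite /lambda_num -addrA lerD2l.
  have -> : (mdeg J - 1 = (mdeg J - m - 1) + m)%N by lia.
  by rewrite [in leRHS]mulrnDr lerD2l ler_wMn2r.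
rewrite mulrAC ler_pdivlMr // ler_wpM2l //.
have : 0 <= nb d *+ (mdeg J - m - 1) by rewrite mulrn_wge0 // ltW.
have : nc d <= nc d *+ m by rewrite -[X in X <= _]mulr1n ler_wpMn2l // ltW.
by rewrite /lambda_den; lra.
Qed.

Variable e : nat -> newton_data Rl n.
Hypothesis eS : forall m, newton_update N delta (e m) (e m.+1).
Hypothesis b_gt0 : 0 < nb (e 0%N).
Hypothesis c_gt0 : 0 < nc (e 0%N).

Lemma traj_nc m : nc (e m) = 2 ^+ m * nc (e 0%N).
Proof.
elim: m => [|m IHm]; first by rewrite mul1r.
by have [_ -> _ _ _] := eS m; rewrite IHm exprS mulrA.
Qed.

Lemma traj_nc_gt0 m : 0 < nc (e m).
Proof. by rewrite traj_nc mulr_gt0 // exprn_gt0. Qed.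

Lemma traj_nc_le m j : (m <= j)%N -> nc (e m) <= nc (e j).
Proof.
move=> mj; rewrite (traj_nc m) (traj_nc j); apply: ler_wpM2r; first exact: ltW.
by apply: ler_weXn2l mj; rewrite ler1n.
Qed.

(** After one step b is at most the initial c, and c only grows, so the minimum never drops
    again. *)
Lemma traj_nb m : nb (e m.+1) = nb (e 1%N).
Proof.
elim: m => // m IHm; have [-> _ _ _ _] := eS m.+1; rewrite IHm.
apply/min_idPl; have [-> _ _ _ _] := eS 0%N.
rewrite ge_min traj_nc; apply/orP; right.
by rewrite ler_peMl ?exprn_ege1 // ?ltW //; lra.
Qed.

Lemma traj_nb_gt0 m : 0 < nb (e m).
Proof.
by case: m => // m; rewrite traj_nb; have [-> _ _ _ _] := eS 0%N; rewrite lt_min b_gt0.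
Qed.

(** Every updated state satisfies b' = min(b, c) <= 2c = c', so [update_lambda_stable] applies from
    the second step on. *)
Lemma traj_lambda m : update_lambda N delta (e m.+2) = 0.
Proof.
apply: (update_lambda_stable (eS m.+1) (traj_nb_gt0 _) (traj_nc_gt0 _)).
have [-> -> _ _ _] := eS m.
have c0 := traj_nc_gt0 m.
by rewrite ge_min; apply/orP; right; lra.
Qed.

Lemma traj_stable m : (2 <= m)%N ->
  [/\ nalpha (e m) = nalpha (e 2%N), nb (e m) = nb (e 2%N)
    & dot (invv (nalpha (e 2%N))) (nbeta (e m)) =
      dot (invv (nalpha (e 2%N))) (nbeta (e 2%N))].
Proof.
case: m => [|[|m]] // _; elim: m => // m [aE _ BE].
have [_ _ aS BS _] := eS m.+2; move: aS BS.
rewrite traj_lambda addr0 scale1r mul0r subr0 aE => aS BS.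
by rewrite !traj_nb BS.
Qed.

End Trajectory.

(** * The simple estimate for the accumulated scaling of alpha *)

Section Estimate.
Variables (Rl : realType) (n k N : nat).
Variable delta : 'I_k -> 'X_{1..k} -> 'rV[Rl]_n.
Variable e : nat -> newton_data Rl n.
Hypothesis eS : forall m, newton_update N delta (e m) (e m.+1).
Hypothesis b_gt0 : 0 < nb (e 0%N).
Hypothesis c_gt0 : 0 < nc (e 0%N).
Hypothesis gb : forall m,
  dot (invv (nalpha (e m))) (ngamma (e m)) <= dot (invv (nalpha (e m))) (nbeta (e m)).
Local Notation a := (nalpha (e 0%N)).
Local Notation M := (estimate_M N delta (e 0%N)).

Lemma estimate_M_ge0 : 0 <= M. Proof. exact: bigmax_ge_id. Qed.

Lemma estimate_M_ge i (J : 'X_{1..k}) : (2 <= mdeg J)%N -> (mdeg J <= N)%N ->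
  dot (invv a) (delta i J) + dot (invv a) (nbeta (e 0%N)) *+ (mdeg J - 1) <= M.
Proof.
move=> J2 JN; have JN1 : (mdeg J < N.+1)%N by [].
rewrite -dotMn -dotD /estimate_M; apply: (bigmax_sup i) => //.
exact: (bigmax_sup (BMultinom JN1)).
Qed.

(** Only two factors 1 + lambda and 1 + lambda' can differ from 1. Their product is 1 + lambda +
    lambda' (1 + lambda) <= 1 + M/c + M/(2c), the source of 3/2. *)
Lemma traj_estimate m : exists t : Rl,
  [/\ 0 < t, t <= 1 + 3 / 2 * (nc (e 0%N))^-1 * M, nalpha (e m) = t *: a
    & dot (invv a) (nbeta (e m)) <= dot (invv a) (nbeta (e 0%N))].
Proof.
have M0 := estimate_M_ge0; have Mc0 : 0 <= M / nc (e 0%N) by rewrite divr_ge0 // ltW.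
have muE : 3 / 2 * (nc (e 0%N))^-1 * M = 3 / 2 * (M / nc (e 0%N)).
  by rewrite -mulrA [_^-1 * _]mulrC.
rewrite muE; case: m => [|m]; first by exists 1; rewrite scale1r; split=> //; lra.
have [_ c1 a1 B1 _] := eS 0%N; set l := update_lambda N delta (e 0%N) in a1 B1.
have l0 : 0 <= l by exact: update_lambda_ge0.
have l1 : l <= M / nc (e 0%N).
  by apply: update_lambda_le_div => //; exact: estimate_M_ge.
have b1 := ltW (traj_nb_gt0 eS b_gt0 c_gt0 1).
have B1' : dot (invv a) (nbeta (e 1%N)) <= dot (invv a) (nbeta (e 0%N)).
  by rewrite B1 gerBl mulr_ge0.
case: m => [|m]; first by exists (1 + l); split=> //; lra.
have [_ _ a2 B2 _] := eS 1%N; set l' := update_lambda N delta (e 1%N) in a2 B2.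
have l'0 : 0 <= l' by exact: update_lambda_ge0.
have tl : 0 < 1 + l by lra.
have tl' : 0 <= (1 + l)^-1 by rewrite invr_ge0 ltW.
(* At [e 1] the bound [M] is scaled by (1 + lambda)^-1, as beta and gamma are still controlled by
   the initial beta, and c has doubled. *)
have l'1 : l' <= (1 + l)^-1 * M / nc (e 1%N).
  apply: update_lambda_le_div => //.
  - exact: traj_nb_gt0 eS _ _ _.
  - exact: traj_nc_gt0 eS _ _.
  - by rewrite mulr_ge0.
  move=> i J J2 JN; rewrite a1 !dot_invvZ -mulrnAr -mulrDr; apply: ler_wpM2l => //.
  apply: le_trans (estimate_M_ge i J2 JN); rewrite lerD2l; exact: ler_wMn2r.
have b2 := ltW (traj_nb_gt0 eS b_gt0 c_gt0 2).
have [-> _ BE] := traj_stable eS b_gt0 c_gt0 (isT : (2 <= m.+2)%N).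
exists ((1 + l') * (1 + l)); split.
- by rewrite mulr_gt0 //; lra.
- have : l' * (1 + l) <= (1 + l)^-1 * M / nc (e 1%N) * (1 + l).
    by rewrite ler_wpM2r // ltW.
  have -> : (1 + l)^-1 * M / nc (e 1%N) * (1 + l) = M / nc (e 0%N) / 2.
    by rewrite c1; field; rewrite !gt_eqF.
  by lra.
- by rewrite a2 a1 scalerA.
apply: le_trans B1'.
have a2E : nalpha (e 2%N) = ((1 + l') * (1 + l)) *: a by rewrite a2 a1 scalerA.
move: BE B2; rewrite a2E a1 !dot_invvZ => BE B2.
have t0 : (1 + l')^-1 * (1 + l)^-1 != 0.
  by rewrite mulf_neq0 // invr_eq0 gt_eqF //; lra.
have -> : dot (invv a) (nbeta (e m.+2)) = dot (invv a) (nbeta (e 2%N)).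
  by apply: (mulfI t0); rewrite -invfM.
rewrite -(ler_pM2l (_ : 0 < (1 + l)^-1)) ?invr_gt0 // B2.
by have := mulr_ge0 l'0 b2; lra.
Qed.

End Estimate.

Lemma exists_pow2_ge (Rl : realType) (c C : Rl) : 0 < c -> exists m0 : nat,
  forall m, (m0 <= m)%N -> C <= 2 ^+ m * c.
Proof.
move=> c0; exists (Num.bound (C / c)) => m mC.
by rewrite -ler_pdivrMr // ltW // upper_nthrootP.
Qed.

(** * The Newton sequence, its data and its limit *)

Section NewtonSequence.
Variables (Rl : realType) (F : fieldType) (v : valuation Rl F) (n k N : nat).
Variable G : 'I_k -> {mpoly {mpoly (vring v)[n]}[k]}.
Hypothesis G_deg : forall j (J : 'X_{1..k}), (N < mdeg J)%N -> (G j)@_J = 0.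
Variable delta : 'I_k -> 'X_{1..k} -> 'rV[Rl]_n.
Variables (z : 'cV[tate v n]_k) (d : newton_data Rl n).
Hypothesis d_adm : admissible G d z.
Hypothesis G_delta : delta_bound G delta (nalpha d).

Lemma newton_data_seq : (0 < n)%N -> (0 < k)%N -> (2 <= N)%N ->
  exists e : nat -> newton_data Rl n,
    e 0%N = d /\ forall m, newton_update N delta (e m) (e m.+1).
Proof.
move=> n0 k0 N2; pose pos (f : newton_data Rl n) := forall i, 0 < nalpha f 0 i.
have /choice[nx nxP] f : exists f', pos f -> newton_update N delta f f' /\ pos f'.
  (* Without positivity [f] itself is a placeholder value, which the trajectory from [d] never
     meets. *)
  have [fp|nfp] := pselect (pos f); last by exists f.
  by have [f' ff' f'p] := newton_update_total delta n0 k0 N2 fp; exists f'.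
pose e m := iter m nx d.
have ep m : pos (e m).
  elim: m => [|m IHm]; first by case: d_adm => -[].
  exact: (nxP _ IHm).2.
by exists e; split=> // m; exact: (nxP _ (ep m)).1.
Qed.

Section Data.
Variable e : nat -> newton_data Rl n.
Hypothesis e0 : e 0%N = d.
Hypothesis eS : forall m, newton_update N delta (e m) (e m.+1).

Lemma newton_adm m :
  admissible G (e m) (newton G z m) /\ delta_bound G delta (nalpha (e m)).
Proof.
elim: m => [|m [adm dG]]; first by rewrite e0.
rewrite newtonS; exact: (newton_step G_deg adm dG (eS m)).
Qed.

Lemma seq_nb_gt0 : 0 < nb (e 0%N).
Proof. by rewrite e0; case: d_adm => -[]. Qed.

Lemma seq_nc_gt0 : 0 < nc (e 0%N).
Proof. by rewrite e0; case: d_adm => -[]. Qed.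

(** The difference is a sum of increments, and their bounds c_m, ..., c_(j-1) are nondecreasing. *)
Lemma newton_cauchy m j i : (m <= j)%N ->
  Vset (nc (e m)) (newton G z j i 0 - newton G z m i 0).
Proof.
elim: j => [|j IHj]; first by rewrite leqn0 => /eqP ->; exact: cong_refl.
rewrite leq_eqVlt => /predU1P[->|mj]; first exact: cong_refl.
rewrite newtonS mxE addrAC; apply: hsetD; first exact: IHj.
apply: hset_le ((newton_incr_bound (newton_adm j).1 i).2) => _.
exact: (traj_nc_le eS seq_nc_gt0).
Qed.

Lemma newton_Wset m i :
  Wset (nalpha (e m)) (nbeta (e m)) (newton G z m i 0).
Proof. by have [_ /(_ i)[]] := (newton_adm m).1. Qed.

Lemma newton_Wset_stable m i : (2 <= m)%N ->
  Wset (nalpha (e 2%N)) (nbeta (e 2%N)) (newton G z m i 0).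
Proof.
move=> m2; have [aE _ BE] := traj_stable eS seq_nb_gt0 seq_nc_gt0 m2.
by apply: Wset_eq BE _; rewrite -aE; exact: newton_Wset.
Qed.

Lemma newton_Wset_estimate m i :
  Wset ((1 + 3 / 2 * (nc d)^-1 * estimate_M N delta d) *: nalpha d) (nbeta d)
    (newton G z m i 0).
Proof.
have gb j : dot (invv (nalpha (e j))) (ngamma (e j)) <=
    dot (invv (nalpha (e j))) (nbeta (e j)) by case: (newton_adm j).1.
have [t []] := traj_estimate eS seq_nb_gt0 seq_nc_gt0 gb m; rewrite e0 => t0 tm aE BE.
by apply: (Wset_weaken t0 tm BE); rewrite -aE; exact: newton_Wset.
Qed.

End Data.

Lemma newton_limit : vcomplete v -> (0 < n)%N -> (0 < k)%N -> (2 <= N)%N ->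
  exists s : 'cV[tate v n]_k, forall m i,
    Vset (2 ^+ m * nc d) (s i 0 - newton G z m i 0).
Proof.
move=> v_complete n0 k0 N2; have [e [e0 eS]] := newton_data_seq n0 k0 N2.
have /fin_all_exists[s sP] i : exists s : tate v n, forall m,
    Vset (2 ^+ m * nc d) (s - newton G z m i 0).
  apply: (tate_limit (u := fun m => newton G z m i 0)) => // [m j mj|C].
    by rewrite -e0 -(traj_nc eS); exact: newton_cauchy.
  have c0 : 0 < nc d by case: d_adm => -[].
  by have [m mP] := exists_pow2_ge C c0; exists m; exact: mP.
by exists (\col_i s i) => m i; rewrite mxE.
Qed.

End NewtonSequence.

Theorem corollary4p16
  (Rl : realType) (p : nat) (p_prime : prime p)
  (Qp : fieldType) (w : valuation Rl Qp) (QpE : is_Qp p w)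
  (K : fieldExtType Qp) (v : valuation Rl K)
  (v_ext : forall a : Qp, v (a%:A) = w a)
  (pi : vring v) (pi_unif : uniformiser pi)
  (n r : nat) (r_lt_n : (r < n)%N)
  (G : 'I_(n - r) -> {mpoly {mpoly (vring v)[n]}[n - r]})
  (N : nat) (N_ge2 : (2 <= N)%N)
  (G_deg : forall j (J : 'X_{1..n - r}), (N < mdeg J)%N -> (G j)@_J = 0)
  (z : 'cV[tate v n]_(n - r)) (d : newton_data Rl n)
  (d_adm : admissible G d z)
  (delta : 'I_(n - r) -> 'X_{1..n - r} -> 'rV[Rl]_n)
  (G_delta : forall i (J : 'X_{1..n - r}), (2 <= mdeg J)%N ->
     Wset (nalpha d) (delta i J) (tate_of_mpoly (G i)@_J)) :
  exists s : 'cV[tate v n]_(n - r),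
  [/\ Gsolution G pi s /\ (forall s', Gsolution G pi s' -> s' = s),
      (forall m, JacG G (newton G z m) \in unitmx) /\
      (forall C : Rl, exists m0, forall m, (m0 <= m)%N ->
         forall i, Vset C (s i 0 - newton G z m i 0)),
      forall e : nat -> newton_data Rl n, e 0%N = d ->
        (forall m, newton_update N delta (e m) (e m.+1)) ->
        [/\ admissible G (e 2%N) (newton G z 2),
            forall m, (2 <= m)%N ->
              [/\ nalpha (e m) = nalpha (e 2%N), nb (e m) = nb (e 2%N)
                & dot (invv (nalpha (e 2%N))) (nbeta (e m)) =
                  dot (invv (nalpha (e 2%N))) (nbeta (e 2%N))],
            forall m, (2 <= m)%N -> forall i,
              Wset (nalpha (e 2%N)) (nbeta (e 2%N)) (newton G z m i 0)
          & forall i, Wset (nalpha (e 2%N)) (nbeta (e 2%N)) (s i 0)]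
    & let mu := 3 / 2 * (nc d)^-1 * estimate_M N delta d in
      (forall m i,
         Wset ((1 + mu) *: nalpha d) (nbeta d) (newton G z m i 0)) /\
      (forall i, Wset ((1 + mu) *: nalpha d) (nbeta d) (s i 0))].

Proof.
have [_ _ Qp_complete] := QpE; have v_complete := fieldExt_complete Qp_complete v_ext.
have n0 : (0 < n)%N by apply: leq_ltn_trans r_lt_n.
have k0 : (0 < n - r)%N by rewrite subn_gt0.
(* One trajectory is fixed for the claims that mention no data; those about [e] treat every
   trajectory. *)
have [e0 [e00 e0S]] := newton_data_seq delta d_adm n0 k0 N_ge2.
have [s sP] := newton_limit G_deg d_adm G_delta v_complete n0 k0 N_ge2.
have c0 : 0 < nc d by case: d_adm => -[].
have s_lim C : exists m0, forall m, (m0 <= m)%N -> forall i,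
    Vset C (s i 0 - newton G z m i 0).
  have [m0 m0P] := exists_pow2_ge C c0; exists m0 => m mm i.
  by apply: hset_le (sP m i) => _; exact: m0P.
have s_Wset e : e 0%N = d -> (forall m, newton_update N delta (e m) (e m.+1)) ->
    forall i, Wset (nalpha (e 2%N)) (nbeta (e 2%N)) (s i 0).
  move=> e_0 eS i; apply: Wset_closed => C; have [m mP] := s_lim C.
  exists (newton G z (maxn 2 m) i 0); last exact/mP/leq_maxr.
  by apply: newton_Wset_stable e_0 eS _ _ (leq_maxl _ _).
have adm m := (newton_adm G_deg d_adm G_delta e00 e0S m).1.
have s_sol : evalG G s = 0.
  apply/matrixP => i j; rewrite ord1 !mxE; apply: VsetP => C; rewrite subr0.
  (* G(s) is congruent to G(z_m) modulo V(2^m c), and G(z_m) lies there by admissibility. *)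
  have [m mP] := exists_pow2_ge C c0.
  rewrite -[evalS _ _](subrK (evalS (G i) (newton G z m))).
  apply: (@hset_le _ _ _ _ (fun=> 2 ^+ m * nc d)) => [_|]; first exact: mP.
  apply: hsetD; first by apply: cong_evalS => q; exact: sP.
  have [_ _ /(_ i)[_ GV] _ _] := adm m.
  by move: GV; rewrite mxE (traj_nc e0S) e00.
have s_pi i : in_pi_dagger pi (s i 0).
  have [[a0 _ _] _ _ _ _] := adm 2%N.
  have [[_ b0 _] zbV _ _ _] := d_adm.
  (* [z] lies in V(b) and s - z in V(c), so [s] lies in V(min(b, c)). *)
  apply: (Wset_in_pi_dagger pi_unif (c := Num.min (nb d) (nc d)) a0).
  - by rewrite lt_min b0.
  - exact: s_Wset.
  rewrite -[s i 0](subrK (z i 0)); apply: hsetD.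
    by apply: hset_le (sP 0%N i) => _; rewrite mul1r ge_min lexx orbT.
  by apply: hset_le (zbV i).2 => _; rewrite ge_min lexx.
exists s; split.
(* Elements of pi R<x>^dagger share a positive lower bound on valuations, so s' - s satisfies it
   too; this starts the bootstrap. *)
- split=> // s' [s'_sol s'_pi]; have [c c_gt0 cP] := in_pi_dagger_Vset n pi_unif.
  apply: (solution_unique (JacG_unit d_adm) c0 c_gt0) s_sol s'_sol => i.
    by have := sP 0%N i; rewrite mul1r.
  by apply: hsetB; exact: cP.
- by split=> // m; exact: JacG_unit (adm m).
- move=> e e_0 eS; split.
  + exact: (newton_adm G_deg d_adm G_delta e_0 eS 2).1.
  + move=> m; apply: (traj_stable eS).
      exact: seq_nb_gt0 d_adm _ e_0.
    exact: seq_nc_gt0 d_adm _ e_0.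
  + by move=> m m2 i; apply: (newton_Wset_stable G_deg d_adm G_delta e_0 eS).
  + exact: s_Wset.
move=> mu; have zW m i : Wset ((1 + mu) *: nalpha d) (nbeta d) (newton G z m i 0).
  exact: newton_Wset_estimate e00 e0S m i.
split=> // i; apply: Wset_closed => C; have [m mP] := s_lim C.
by exists (newton G z m i 0) => //; exact: mP.
Qed.
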